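(* Let $a>b>0$, let $\mathcal{E}:\ \frac{\mathsf{x}^2}{a}+\frac{\mathsf{y}^2}{b}=1$, and let $\mathcal{C}_{\lambda_0}$, $\lambda_0\in(0,b)\cup(b,a)$, be a conic confocal with $\mathcal{E}$. Let $$\sqrt{(a-x)(b-x)(\lambda_0-x)}=\sum_{i\ge0}B_ix^i,\quad \frac{\sqrt{(a-x)(b-x)(\lambda_0-x)}}{\lambda_0-x}=\sum_{i\ge0}C_ix^i,\quad \frac{\sqrt{(a-x)(b-x)(\lambda_0-x)}}{b-x}=\sum_{i\ge0}D_ix^i$$ be the Taylor expansions around $x=0$. Let $n\ge2$ be an integer. A billiard trajectory within $\mathcal{E}$ with caustic $\mathcal{C}_{\lambda_0}$ is $n$-elliptic periodic without being $n$-periodic if and only if one of the following conditions is satisfied: (a) $\mathcal{C}_{\lambda_0}$ is an ellipse and - for $n=2m$ even: $\det(C_{i+j-1})_{i,j=1}^m=0$ (i.e. $C_1=0$ for $n=2$, $\begin{vmatrix} C_1 & C_2 \\ C_2 & C_3 \end{vmatrix}=0$ for $n=4$, etc.); - for $n=2m+1$ odd: $\det(B_{i+j})_{i,j=1}^m=0$ (i.e. $B_2=0$ for $n=3$, $\begin{vmatrix} B_2 & B_3 \\ B_3 & B_4 \end{vmatrix}=0$ for $n=5$, etc.); (b) $\mathcal{C}_{\lambda_0}$ is a hyperbola and - for $n=2m$ even: $\det(D_{i+j-1})_{i,j=1}^m=0$; - for $n=2m+1$ odd: $\det(B_{i+j})_{i,j=1}^m=0$; (c) $\mathcal{C}_{\lambda_0}$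 is a hyperbola, $n=2m+1$ is odd, and $\det(D_{i+j})_{i,j=1}^m=0$ (i.e. $D_2=0$ for $n=3$, $\begin{vmatrix} D_2 & D_3 \\ D_3 & D_4 \end{vmatrix}=0$ for $n=5$, etc.).
   Context: The confocal family is $\mathcal{C}_{\lambda}:\ \frac{\mathsf{x}^2}{a-\lambda}+\frac{\mathsf{y}^2}{b-\lambda}=1$; $\mathcal{C}_\lambda$ is an ellipse for $\lambda<b$, a hyperbola for $\lambda\in(b,a)$, with degenerate members the $\mathsf{x}$-axis ($\lambda=b$) and the $\mathsf{y}$-axis ($\lambda=a$). Billiard trajectories within $\mathcal{E}$ are polygonal lines with vertices on $\mathcal{E}$ obeying the reflection law at each vertex; a trajectory has caustic $\mathcal{C}_{\lambda_0}$ if all lines containing its segments are tangent to $\mathcal{C}_{\lambda_0}$. A trajectory is $n$-periodic if it closes after $n$ reflections ($n$ not required to be minimal). Every point other than the foci lies on exactly two conics $\mathcal{C}_{\lambda_1},\mathcal{C}_{\lambda_2}$, $\lambda_1<\lambda_2$; $(\lambda_1,\lambda_2)$ are its elliptic coordinates. A trajectory is $n$-elliptic periodic if it is $n$-periodic in elliptic coordinates, i.e. the elliptic coordinates of the moving point along the trajectory repeat periodically after $n$ reflections. *)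

(* Defs.v *)
From HB Require Import structures.
From mathcomp Require Export all_boot all_order all_algebra.
From mathcomp Require Export all_classical all_reals all_analysis.
Export Order.TTheory GRing.Theory Num.Theory.
Export numFieldNormedType.Exports.

#[export] Set Implicit Arguments.
#[export] Unset Strict Implicit.
#[export] Unset Printing Implicit Defensive.

#[global] Open Scope classical_set_scope.
#[global] Open Scope ring_scope.

Section Plane.
Variable R : realType.
Implicit Types P Q T : 'rV[R]_2.

Definition xc P : R := P 0 0.
Definition yc P : R := P 0 1.

Definition dot P Q : R := xc P * xc Q + yc P * yc Q.
(* The library norm on 'rV[R]_2 is the sup norm, hence an explicit one. *)
Definition enorm P : R := Num.sqrt (dot P P).
Definition direction P Q : 'rV[R]_2 := (enorm (Q - P))^-1 *: (Q - P).

End Plane.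

Section Confocal.
Variables (R : realType) (a b : R).
Implicit Types (P Q T : 'rV[R]_2) (l : R).

Definition on_ellipse P : Prop := xc P ^+ 2 / a + yc P ^+ 2 / b = 1.

(* The members l = b and l = a of the family are the coordinate axes. *)
Definition on_confocal l P : Prop :=
  if l == a then xc P = 0
  else if l == b then yc P = 0
  else xc P ^+ 2 / (a - l) + yc P ^+ 2 / (b - l) = 1.

Definition is_ellipse l : Prop := l < b.
Definition is_hyperbola l : Prop := b < l < a.

(* For l different from a and b: the line through the distinct points P and Q
   is the tangent of the conic l at its point with homogeneous coordinates
   (X : Y : Z).  Z = 0 is allowed, so that, as in the projective plane, the
   asymptotes of a hyperbola are among its tangents. *)
Definition tangent_line l P Q : Prop :=
  exists X Y Z : R,
    [/\ (X, Y, Z) <> (0, 0, 0),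
        X ^+ 2 / (a - l) + Y ^+ 2 / (b - l) = Z ^+ 2,
        xc P * X / (a - l) + yc P * Y / (b - l) = Z
      & xc Q * X / (a - l) + yc Q * Y / (b - l) = Z].

Definition elliptic_coordinates P (l1 l2 : R) : Prop :=
  [/\ l1 < l2, on_confocal l1 P & on_confocal l2 P].

Definition same_elliptic_coordinates P Q : Prop :=
  forall l1 l2, elliptic_coordinates P l1 l2 <-> elliptic_coordinates Q l1 l2.

(* Normal to the ellipse at its point P: half the gradient of x^2/a + y^2/b. *)
Definition normal P : 'rV[R]_2 :=
  \row_(j < 2) (if j == 0 then xc P / a else yc P / b).

(* The outgoing unit direction at Q is the mirror image of the incoming one in
   the tangent to the ellipse at Q. *)
Definition reflection_law P Q T : Prop :=
  direction Q T =
  direction P Q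
    - (2 * dot (direction P Q) (normal Q) / dot (normal Q) (normal Q))
        *: normal Q.

(* A trajectory is given by the sequence of its successive vertices. *)
Definition billiard_trajectory (V : nat -> 'rV[R]_2) : Prop :=
  [/\ forall k, on_ellipse (V k),
      forall k, V k <> V k.+1
    & forall k, reflection_law (V k) (V k.+1) (V k.+2)].

Definition has_caustic (V : nat -> 'rV[R]_2) l : Prop :=
  forall k, tangent_line l (V k) (V k.+1).

Definition periodic (n : nat) (V : nat -> 'rV[R]_2) : Prop :=
  forall k, V (k + n)%N = V k.

(* The moving point after k reflections and a fraction s of the next segment. *)
Definition moving_point (V : nat -> 'rV[R]_2) (k : nat) (s : R) : 'rV[R]_2 :=
  V k + s *: (V k.+1 - V k).

Definition elliptic_periodic (n : nat) (V : nat -> 'rV[R]_2) : Prop :=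
  forall (k : nat) (s : R), 0 <= s <= 1 ->
    same_elliptic_coordinates (moving_point V (k + n)%N s) (moving_point V k s).

End Confocal.

(* f(x) = \sum_(i >= 0) c_i x^i for all x in a neighbourhood of 0. *)
Definition taylor_expansion_at0 (R : realType) (f : R -> R) (c : nat -> R) :
    Prop :=
  \forall x \near (0 : R), pseries c x @ \oo --> f x.

Definition sqrt_cubic (R : realType) (a b l x : R) : R :=
  Num.sqrt ((a - x) * (b - x) * (l - x)).

(* Main.v *)
Require Import Defs.
From mathcomp Require Import zify ring lra.

(** Write [e], [f] for the quadratic form of the confocal pencil, cleared of
    denominators, evaluated on (velocity, velocity) and (position, velocity),
    and [g] for 1 minus its value on (position, position).  For a unit velocity
    [f^2 + e g] is the cubic [P(z) = (a - z) (b - z) (l - z)], with [l] the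
    parameter of the caustic, and a bounce conjugates the matrix
    [L = ((f, g), (e, - f))] by an explicit matrix with entries of degree at
    most 1 in [z].  If [N] is the product of [n] of
    these matrices, [N] has determinant [z^(2n)], and [N(a) / a^n], [N(b) / b^n]
    are the [n]-th iterate of the billiard map on the [x]- and [y]-coordinates.

    Elliptic periodicity means that [n] bounces change position and velocity by
    the signs [c1], [c2] of the coordinates.  In that case [N] commutes with [L],
    so [N = p + q L] with [p^2 - q^2 P = z^(2n)] and [p(a) = c1 a^n],
    [p(b) = c2 b^n].  The sign of [p(z) / z^n] at the roots of [P] can only change
    across an interval where [P < 0]; hence [(p - z^n) (p + z^n) = q^2 P] splits
    as [f1 r^2], [g1 s^2] with [f1 g1 = P], each factorization of [P]
    corresponding to one of the cases.  Truncating, [r] and [s] solve the linear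
    system of a Pade approximation of [sqrt P / f1], which is singular exactly
    when its Hankel determinant vanishes.  Conversely a kernel vector yields a
    solution [(p, q)] of Pell's equation, and [p + q L], which vanishes to the
    order [2n] on the same branch over [z = 0] as [N], must be proportional to
    [N]. *)

(** The workhorse for ideal membership: each use subtracts a hypothesis multiplied by its cofactor
    [k], until an identity remains that [ring] can check. *)
Lemma eq_of_lincomb (T : comPzRingType) (k p q u v : T) :
  u = v -> p - q = k * (u - v) -> p = q.
Proof. by move=> -> H; apply/eqP; rewrite -subr_eq0 H subrr mulr0. Qed.

(* [hornerE] exposes semigroup laws that [ring] does not recognize. *)
Definition hornerS :=
  (hornerD, hornerN, hornerMn, hornerM, horner_exp, hornerC, hornerX).

(** * Auxiliary facts on polynomials over a field *)

Section PolyAux.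
Variable R : fieldType.
Implicit Types (p q : {poly R}) (i j m : nat).

Lemma dvdp_X p : ('X %| p) = (p.[0] == 0).
Proof. by rewrite -[X in X %| _]subr0 -[0 in LHS]polyC0 dvdp_XsubCl. Qed.

Lemma size_mul_leqS p q i j : (size p <= i.+1)%N -> (size q <= j.+1)%N ->
  (size (p * q)%R <= (i + j).+1)%N.
Proof.
move=> pi qj; apply: leq_trans (size_polyMleq _ _) _.
by move: pi qj; move: (size p) (size q) => [|u] [|v]; lia.
Qed.

Lemma coef_mul_top p q i j : (size p <= i.+1)%N -> (size q <= j.+1)%N ->
  (p * q)`_(i + j) = p`_i * q`_j.
Proof.
move=> pi qj; have ii : (i < (i + j).+1)%N by lia.
rewrite coefM (bigD1 (Ordinal ii)) //= addKn big1 ?addr0 // => k.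
rewrite -val_eqE /= => ki; have [lt|ge] := ltnP k i.
  by rewrite (nth_default _ (_ : size q <= i + j - k)%N) ?mulr0 //; lia.
rewrite (nth_default _ (_ : size p <= k)%N) ?mul0r //.
by apply: leq_trans pi _; lia.
Qed.

Lemma dvdXn_eq p m : 'X^m %| p -> (size p <= m.+1)%N -> p = (p`_m)%:P * 'X^m.
Proof.
move=> /dvdpP[q ->]; rewrite coefMXn ltnn subnn.
have [->|q0] := eqVneq q 0; first by rewrite mul0r coef0 mul0r.
rewrite size_mulXn // -[X in (_ <= X)%N]addn1 leq_add2l => sq.
by rewrite [in LHS](size1_polyC sq).
Qed.

End PolyAux.

(** * Hankel determinants and Pell's equation *)

Section Hankel.
Variable R : fieldType.

Lemma dvdXnP (p : {poly R}) n :
  reflect (forall i, (i < n)%N -> p`_i = 0) ('X^n %| p).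
Proof.
apply: (iffP idP) => [/dvdpP[q ->] i lt_in|p0]; first by rewrite coefMXn lt_in.
rewrite -[p](poly_take_drop n) [take_poly n p](_ : _ = 0) ?add0r ?dvdp_mull //.
apply/polyP => i; rewrite coef_take_poly coef0; case: ifP => // lt_in.
exact: p0.
Qed.

(** A Pade problem. The free polynomial [r] absorbs the coefficients of index below [n - m], so only
    those of index [n - m] to [n - 1] impose conditions on [s]. They are the coefficients of [s], in
    reverse order, multiplied by the Hankel matrix. *)
Lemma hankel_det0 (E : nat -> R) m n K : (m + m <= n)%N -> (n <= K)%N ->
  \det (\matrix_(i < m, j < m) E (i + j + (n - (m + m)).+1)%N) = 0 <->
  exists r s : {poly R}, [/\ s != 0, (size s <= m)%N, (size r <= n - m)%N &
    'X^n %| r + s * \poly_(i < K) E i].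
Proof.
move=> le_2m le_nK; set M := \matrix_(i, j) _.
have coef_sE (w : 'rV[R]_m) (j : 'I_m) :
    (rVpoly w * \poly_(i < K) E i)`_(n - m + j) =
    ((\row_i w 0 (rev_ord i)) *m M) 0 j.
  rewrite [rVpoly w]poly_def mulr_suml coef_sum !mxE.
  rewrite [RHS](reindex_inj rev_ord_inj).
  apply: eq_bigr => i _; rewrite !mxE rev_ordK valK -scalerAl coefZ coefXnM.
  have := ltn_ord i; have := ltn_ord j => lj li; congr (_ * _).
  rewrite ltnNge (_ : (i <= _)%N) /=; last by lia.
  rewrite coef_poly (_ : (_ < K)%N); last by lia.
  by congr E; lia.
split=> [/eqP/det0P[v v0 vM]|[r [s [s0 sm sr dv]]]].
  set w := \row_i v 0 (rev_ord i).
  have vw : v = \row_i w 0 (rev_ord i).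
    by apply/rowP => i; rewrite !mxE rev_ordK.
  have s0 : rVpoly w != 0.
    apply: contra v0 => /eqP w0; rewrite vw; apply/eqP/rowP => i.
    by rewrite [RHS]mxE mxE -coef_rVpoly_ord w0 coef0.
  exists (- take_poly (n - m) (rVpoly w * \poly_(i < K) E i)), (rVpoly w).
  split=> //; rewrite ?size_poly ?size_polyN ?size_take_poly //.
  apply/dvdXnP => i lt_in; rewrite coefD coefN coef_take_poly.
  case: ltnP => [_|ge]; first by rewrite addNr.
  have lt_im : (i - (n - m) < m)%N by lia.
  have := coef_sE w (Ordinal lt_im); rewrite /= subnKC // => ->.
  by rewrite -vw vM mxE oppr0 add0r.
apply/eqP/det0P; exists (\row_i (poly_rV s : 'rV_m) 0 (rev_ord i)).
  apply: contra s0 => /eqP w0; rewrite -(poly_rV_K sm).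
  suff -> : poly_rV s = 0 :> 'rV_m by rewrite linear0.
  by apply/rowP => i; move/rowP/(_ (rev_ord i)): w0; rewrite !mxE rev_ordK.
apply/rowP => j; rewrite -coef_sE poly_rV_K // mxE.
have lt_j : (n - m + j < n)%N by have := ltn_ord j; lia.
have /dvdXnP/(_ _ lt_j) := dv; rewrite coefD.
by rewrite [r`__]nth_default ?add0r // (leq_trans sr) // leq_addr.
Qed.

End Hankel.

(** * From a factorization of the cubic to a solution of Pell's equation *)

Section Splitting.
Variable R : realFieldType.

Lemma size_sqr (p : {poly R}) : p != 0 ->
  size (p ^+ 2) = (size p).-1.*2.+1.
Proof.
by move=> p0; rewrite -muln2 -size_exp prednK // size_poly_gt0 expf_neq0.
Qed.

Lemma coprimep_Xn (p : {poly R}) n : p.[0] != 0 -> coprimep p 'X^n.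
Proof.
by move=> p0; rewrite coprimep_expr // -['X]subr0 -polyC0 coprimep_XsubC.
Qed.

(* For [Y] a branch at 0 of the square root of [f * g], the function
   [r * f + s * sqrt (f * g)] on the curve vanishes to order [n] on that
   branch; [r] and [s] have too few coefficients for this to be automatic. *)
Definition split_at0 n (f Y : {poly R}) :=
  exists r s : {poly R}, [/\ s != 0, (size s <= n./2)%N,
    (size r <= n - n./2)%N & 'X^n %| f * r + s * Y].

(** The offset [n - 2 m] is the parity of [n], which is why the determinants start at index 1 for
    even [n] and at index 2 for odd [n]. Multiplication by [f], a unit at 0, turns the Pade problem
    for [Y / f] into the divisibility in [split_at0]. *)
Lemma split_at0_det m n K (f Y : {poly R}) (E : nat -> R) :
  n./2 = m -> (n <= K)%N -> f.[0] != 0 ->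
  'X^K %| f * \poly_(i < K) E i - Y ->
  \det (\matrix_(i < m, j < m) E (i + j + (odd n).+1)%N) = 0 <->
  split_at0 n f Y.
Proof.
move=> nm nK f0 dE; rewrite /split_at0 nm.
have E2 : (n - (m + m) = odd n)%N.
  by rewrite -[n in LHS]odd_double_half nm -addnn addnK.
have le_mn : (m + m <= n)%N.
  by rewrite -[n]odd_double_half nm addnn leq_addl.
have := hankel_det0 E le_mn nK; rewrite E2 => ->.
have iffd r s : 'X^n %| r + s * \poly_(i < K) E i = ('X^n %| f * r + s * Y).
  rewrite -[LHS](Gauss_dvdpr _ (_ : coprimep _ f)); last first.
    by rewrite coprimep_sym coprimep_Xn.
  have -> : f * (r + s * \poly_(i < K) E i) =
    (f * r + s * Y) + s * (f * \poly_(i < K) E i - Y) by ring.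
  rewrite dvdp_addl // dvdp_mull //; apply: dvdp_trans dE.
  by rewrite dvdp_exp2l.
by split=> -[r [s [H1 H2 H3 H4]]]; exists r, s; split=> //;
  rewrite ?iffd // -iffd.
Qed.


(** With [r] the gcd of [u] and [q], write [u = u1 r] and [q = q1 r], so that [u1 v = r q1^2]. Then
    [u1] divides [r], being coprime to [q1], and [r] divides [u1], being coprime to [v]; the two
    differ by a constant. *)
Lemma coprime_mul_sqr (u v q : {poly R}) : u != 0 -> coprimep u v ->
  u * v = q ^+ 2 -> exists c r, u = c%:P * r ^+ 2.
Proof.
move=> u0 cuv uvq; set r := gcdp u q.
have r0 : r != 0 by rewrite gcdp_eq0 (negPf u0).
have /dvdpP[u1 Eu] : r %| u by exact: dvdp_gcdl.
have /dvdpP[q1 Eq] : r %| q by exact: dvdp_gcdr.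
have E : u1 * v = r * q1 ^+ 2.
  apply: (mulfI r0); rewrite mulrA [r * u1]mulrC -Eu uvq Eq; ring.
have cu1 : coprimep u1 q1.
  have : r * gcdp u1 q1 %= r.
    apply: eqp_trans (mulp_gcdr _ _ _) _; rewrite [r * u1]mulrC [r * q1]mulrC.
    by rewrite -Eu -Eq eqpxx.
  by rewrite -[X in _ %= X]mulr1 eqp_mul2l // gcdp_eqp1.
have : u1 %= r.
  rewrite /eqp; apply/andP; split.
    rewrite -(Gauss_dvdpl _ (coprimep_expr 2 cu1)) -E.
    exact: dvdp_mulIl.
  have cr : coprimep r v by apply: coprimep_dvdr cuv; exact: dvdp_gcdl.
  by rewrite -(Gauss_dvdpl _ cr) E dvdp_mulIl.
case/eqpP => -[c d] /= /andP[c0 d0] H.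
exists (d / c), r; rewrite Eu expr2 mulrA; congr (_ * _).
apply: (scalerI c0); rewrite H -!mul_polyC mulrA -polyCM; congr (_%:P * _).
by field.
Qed.

(* [f r^2 - g s^2] is divisible by ['X^n] because it is a norm; its degree is at
   most [n], and the two terms cannot cancel since [f * g] has odd degree. *)
Lemma pell_of_split n (P Y f g r s : {poly R}) : f * g = P ->
  f.[0] != 0 -> 'X^(n.*2) %| P - Y ^+ 2 -> 'X^n %| f * r + s * Y ->
  s != 0 -> g != 0 -> odd (size f + size g) ->
  (size (f * r ^+ 2)%R <= n.+1)%N -> (size (s ^+ 2 * g)%R <= n.+1)%N ->
  exists c, let p := f * r ^+ 2 + s ^+ 2 * g in let q := - (r * s *+ 2) in
  [/\ f * r ^+ 2 - s ^+ 2 * g = c%:P * 'X^n /\ c != 0,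
    p ^+ 2 - q ^+ 2 * P = (c ^+ 2)%:P * 'X^(n.*2),
    'X^(n.*2) %| p - q * Y, (size p <= n.+1)%N &
    p`_n = if odd (n + size f) then c else - c].
Proof.
move=> fgP f0 dY dn s0 g0 oddfg szf szg.
have /dvdXn_eq Hc : 'X^n %| f * r ^+ 2 - s ^+ 2 * g.
  rewrite -(Gauss_dvdpr _ (_ : coprimep _ f)); last first.
    by rewrite coprimep_sym coprimep_Xn.
  have -> : f * (f * r ^+ 2 - s ^+ 2 * g) =
    (f * r - s * Y) * (f * r + s * Y) - s ^+ 2 * (P - Y ^+ 2).
    by rewrite -fgP; ring.
  apply: dvdp_sub; first exact: dvdp_mull.
  apply: dvdp_mull; apply: dvdp_trans dY.
  by rewrite dvdp_exp2l // -addnn leq_addr.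
have {}Hc : f * r ^+ 2 - s ^+ 2 * g = ((f * r ^+ 2 - s ^+ 2 * g)`_n)%:P * 'X^n.
  apply: Hc; apply: leq_trans (size_polyD _ _) _.
  by rewrite geq_max size_polyN szf.
set c := (X in X%:P * _) in Hc.
have fn0 : f != 0 by apply: contra_neq f0 => ->; rewrite horner0.
have sz2 (w z : {poly R}) : w != 0 -> z != 0 ->
    size (w * z ^+ 2)%R = (size w + (size z).-1.*2)%N.
  by move=> w0 z0; rewrite size_mul ?expf_neq0 // size_sqr // addnS.
(* The size of [f * w^2] has the parity of the size of [f]. Hence the parity of [n + size f] decides
   which of the two terms can reach degree [n], and so whether the sum has top coefficient [c] or
   [- c]. *)
have oddf (w : {poly R}) : w != 0 -> (size (f * w ^+ 2)%R == n.+1) ->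
    odd (n + size f).
  move=> w0; rewrite sz2 // => /eqP /(congr1 odd).
  by rewrite oddD odd_double addbF oddD => -> /=; case: (odd n).
have oddg : (size (s ^+ 2 * g)%R == n.+1) -> ~~ odd (n + size f).
  rewrite mulrC sz2 // => /eqP /(congr1 odd).
  rewrite oddD odd_double addbF oddD => sg.
  by move: oddfg; rewrite oddD sg /=; case: (odd n); case: (odd _).
have cr : odd (n + size f) = false -> (f * r ^+ 2)`_n = 0.
  move=> on; have [->|r0] := eqVneq r 0; first by rewrite expr0n mulr0 coef0.
  rewrite nth_default // -ltnS ltn_neqAle szf andbT.
  by apply/negP => /(oddf _ r0); rewrite on.
have cs : odd (n + size f) -> (s ^+ 2 * g)`_n = 0.
  move=> on; rewrite nth_default // -ltnS ltn_neqAle szg andbT.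
  by apply/negP => /oddg; rewrite on.
exists c; split.
- split=> //; apply/eqP => c0; move: Hc; rewrite c0 mul0r => /eqP.
  rewrite subr_eq0 => /eqP E; have r0 : r != 0.
    apply: contra_neq s0 => r0; move: E; rewrite r0 expr0n mulr0 => /esym/eqP.
    by rewrite mulf_eq0 (negPf g0) orbF expf_eq0 => /eqP.
  move: (congr1 (fun w : {poly R} => odd (size w)) E); rewrite /=.
  rewrite [s ^+ 2 * g]mulrC !sz2 // !oddD !odd_double !addbF => ee.
  by move: oddfg; rewrite oddD ee addbb.
- rewrite polyC_exp -addnn exprD.
  have -> : (c%:P ^+ 2 * ('X^n * 'X^n)) = (c%:P * 'X^n) ^+ 2 by ring.
  by rewrite -Hc -fgP; ring.
- rewrite -(Gauss_dvdpr _ (_ : coprimep _ f)); last first.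
    by rewrite coprimep_sym coprimep_Xn.
  have -> : f * (f * r ^+ 2 + s ^+ 2 * g - - (r * s *+ 2) * Y) =
     (f * r + s * Y) ^+ 2 + s ^+ 2 * (P - Y ^+ 2) by rewrite -fgP; ring.
  apply: dvdp_add; last exact: dvdp_mull.
  by rewrite -muln2 exprM dvdp_exp2r.
- by apply: leq_trans (size_polyD _ _) _; rewrite geq_max szf.
- rewrite /c coefB coefD; case: ifPn => [/cs ->|/negPf/cr ->].
    by rewrite addr0 subr0.
  by rewrite add0r sub0r opprK.
Qed.

End Splitting.

(** * From a solution of Pell's equation to a factorization of the cubic *)

Section SquareSplitting.
Variable R : rcfType.

(** Being coprime with square product, [U] and [V] are constants [c] and [d'] times squares [r^2]
    and [s^2]. The product [c d'] is positive, because [U V = q^2] does not vanish at 0, so [d' / c]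
    has a square root [k]. Modulo ['X^n], the relation times [f / c] becomes
    [(f r)^2 = (k s Y)^2]. *)
Lemma split_of_pell n m (f g U V q Y : {poly R}) (d : R) :
  f * U - g * V = d%:P * 'X^n -> U * V = q ^+ 2 -> coprimep U V ->
  f.[0] != 0 -> U.[0] != 0 -> V.[0] != 0 -> 'X^n %| f * g - Y ^+ 2 ->
  (size V <= m.*2)%N -> (size U <= (n - m).*2)%N ->
  exists r s : {poly R}, [/\ s != 0, (size s <= m)%N, (size r <= n - m)%N &
    'X^n %| f * r + s * Y].
Proof.
move=> E UV cop f0 U0 V0 dY sV sU.
have nz (w : {poly R}) : w.[0] != 0 -> w != 0.
  by apply: contra_neq => ->; rewrite horner0.
have [c [r EU]] := coprime_mul_sqr (nz _ U0) cop UV.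
have [||d' [s EV]] := @coprime_mul_sqr _ V U q (nz _ V0).
- by rewrite coprimep_sym.
- by rewrite mulrC.
have [c0 r0] : c != 0 /\ r.[0] != 0.
  apply/andP; move: U0; rewrite EU hornerM hornerC horner_exp.
  by rewrite mulf_eq0 expf_eq0 negb_or.
have [d0 s0] : d' != 0 /\ s.[0] != 0.
  apply/andP; move: V0; rewrite EV hornerM hornerC horner_exp.
  by rewrite mulf_eq0 expf_eq0 negb_or.
have cd : 0 < c * d'.
  have := congr1 (horner^~ 0) UV; rewrite EU EV !hornerS => H.
  have : 0 <= c * d' * (r.[0] * s.[0]) ^+ 2.
    rewrite (_ : _ * _ = q.[0] ^+ 2) ?sqr_ge0 //.
    by apply: (eq_of_lincomb (k := 1) H); ring.
  rewrite pmulr_lge0; last by rewrite exprn_even_gt0 // mulf_neq0.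
  by rewrite le_eqVlt eq_sym mulf_eq0 (negPf c0) (negPf d0).
have dc : 0 <= d' / c.
  rewrite (_ : d' / c = c * d' * (c ^-1) ^+ 2); last by field.
  by rewrite mulr_ge0 ?sqr_ge0 // ltW.
set k := Num.sqrt (d' / c).
have k2 : k ^+ 2 = d' / c by rewrite sqr_sqrtr.
have k0 : k != 0 by rewrite -sqrf_eq0 k2 mulf_neq0 ?invr_eq0.
set s' := k%:P * s.
have sz (w : {poly R}) (x : R) j : x != 0 -> (size (x%:P * w ^+ 2)%R <= j.*2)%N ->
    (size w <= j)%N.
  move=> x0; rewrite mul_polyC size_scale //.
  have [->|w0] := eqVneq w 0; first by rewrite size_poly0.
  have : (0 < size w)%N by rewrite size_poly_gt0.
  by rewrite size_sqr //; case: (size w) => // z _; rewrite ltn_double.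
have D : 'X^n %| (f * r - s' * Y) * (f * r + s' * Y).
  have -> : (f * r - s' * Y) * (f * r + s' * Y) =
    (d / c)%:P * f * 'X^n + s' ^+ 2 * (f * g - Y ^+ 2).
    have k2P := congr1 polyC k2; have cP : c%:P * (c^-1)%:P = 1 :> {poly R}.
      by rewrite -polyCM mulfV.
    rewrite EU EV in E; rewrite /s'.
    rewrite polyC_exp polyCM in k2P; rewrite polyCM.
    apply: (eq_of_lincomb (k := (c^-1)%:P * f) E).
    apply: (eq_of_lincomb (k := - (f * r) ^+ 2) cP).
    by apply: (eq_of_lincomb (k := - f * g * s ^+ 2) k2P); ring.
  by apply: dvdp_add; apply: dvdp_mull.
have fin (w : {poly R}) : size w = size r -> 'X^n %| f * w + s' * Y ->
  exists r s : {poly R}, [/\ s != 0, (size s <= m)%N, (size r <= n - m)%N &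
    'X^n %| f * r + s * Y].
  move=> sw dw; exists w, s'; split=> //.
  - by rewrite mulf_neq0 ?polyC_eq0 // nz.
  - by rewrite /s' mul_polyC size_scale // (sz _ d') // -EV.
  - by rewrite sw (sz _ c) // -EU.
(* The two factors add up to [2 f r], which is nonzero at 0, so one of them is prime to ['X] and the
   other one carries all of ['X^n]. Replacing [r] by [- r] exchanges them up to sign. *)
have [z|z] := eqVneq (f * r - s' * Y).[0] 0.
  have cp : coprimep 'X^n (f * r + s' * Y).
    rewrite coprimep_sym coprimep_Xn //.
    have -> : f * r + s' * Y = (f * r) *+ 2 - (f * r - s' * Y) by ring.
    by rewrite hornerD hornerN z subr0 hornerMn hornerM mulrn_eq0 /= mulf_neq0.
  apply: (fin (- r)); first by rewrite size_polyN.
  have -> : f * - r + s' * Y = - (f * r - s' * Y) by ring.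
  by rewrite dvdpNr -(Gauss_dvdpl _ cp).
apply: (fin r) => //; rewrite Gauss_dvdpr // in D.
by rewrite coprimep_sym coprimep_Xn.
Qed.

Lemma sign_ivt (p : {poly R}) u v : u <= v ->
  (forall z, u <= z <= v -> p.[z] != 0) -> 0 < p.[u] * p.[v].
Proof.
move=> uv nz; rewrite lt_neqAle eq_sym mulf_neq0 ?nz ?lexx ?uv // leNgt /=.
apply/negP => neg.
have [k k0] : exists2 z, u <= z <= v & root (p.[v] *: p) z.
  (* Scaling by [p.[v]] makes the value at [v] a square, so a single orientation of the sign change
     has to be treated. *)
  apply: poly_ivt => //; rewrite !hornerZ -expr2 sqr_ge0 andbT mulrC.
  exact: ltW.
rewrite rootE hornerZ mulf_eq0 !(negPf (nz _ _)) ?lexx ?uv //.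
Qed.

End SquareSplitting.

(** * Recovering the transfer matrix from a solution of Pell's equation *)

Section PellUnique.
Variable R : realFieldType.

(* [p + q L] and the transfer matrix [N] both kill the same branch to order
   [2n] at 0, so that [N (p - q L) / 'X^(2n)] is polynomial; by degree it is a
   constant triangular matrix, and its off-diagonal entry vanishes because the
   first row of [N] does at 0. *)
Lemma pell_unique n (A B C D F E G p q Y Q : {poly R}) (c : R) : (1 < n)%N ->
  (size A <= n.+1)%N -> (size B <= n.+1)%N -> (size C <= n)%N ->
  (size D <= n.+1)%N -> A`_n = 1 -> D`_n = 1 ->
  (size F <= 2)%N -> (size E <= 2)%N -> (size G <= 3)%N ->
  A.[0] = 0 -> B.[0] = 0 -> D.[0] != 0 -> G.[0] = 0 ->
  F ^+ 2 + E * G = Q ->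
  'X^(n.*2) %| A * (F - Y) + B * E -> 'X^(n.*2) %| C * (F - Y) + D * E ->
  'X^(n.*2) %| A * G - B * (F + Y) -> 'X^(n.*2) %| C * G - D * (F + Y) ->
  'X^(n.*2) %| p - q * Y -> p ^+ 2 - q ^+ 2 * Q = (c ^+ 2)%:P * 'X^(n.*2) ->
  (size p <= n.+1)%N -> (size q <= n.-1)%N -> p`_n ^+ 2 = c ^+ 2 -> c != 0 ->
  [/\ (c ^+ 2)%:P * A = (p`_n)%:P * (p + F * q),
      (c ^+ 2)%:P * B = (p`_n)%:P * (G * q),
      (c ^+ 2)%:P * C = (p`_n)%:P * (E * q) &
      (c ^+ 2)%:P * D = (p`_n)%:P * (p - F * q)].
Proof.
case: n => [//|[//|n]]; set N := n.+2.
have N1 : N.*2 = (N.+1 + n).+1 by rewrite /N; lia.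
have N2 : N.*2 = (N.+2 + n)%N by rewrite /N; lia.
have N4 : N.+2 = (N + 1).+1 by rewrite addn1.
have N5 : N.+3 = (N + 2).+1 by rewrite addn2.
have N3 : N.*2 = (n.+1 + N).+1 by rewrite /N; lia.
move=> _ sA sB sC sD A1 D1 sF sE sG A0 B0 D0 G0 EP kA kC kB kD dpq pell sp sq.
move=> pn c0.
have pn0 : p`_N != 0 by rewrite -sqrf_eq0 pn sqrf_eq0.
have /dvdXn_eq W11 : 'X^(N.*2) %| A * p - (A * F + B * E) * q.
  have -> : A * p - (A * F + B * E) * q =
    A * (p - q * Y) - q * (A * (F - Y) + B * E) by ring.
  by apply: dvdp_sub; apply: dvdp_mull.
have /dvdXn_eq W12 : 'X^(N.*2) %| B * p - (A * G - B * F) * q.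
  have -> : B * p - (A * G - B * F) * q =
    B * (p - q * Y) - q * (A * G - B * (F + Y)) by ring.
  by apply: dvdp_sub; apply: dvdp_mull.
have /dvdXn_eq W21 : 'X^(N.*2) %| C * p - (C * F + D * E) * q.
  have -> : C * p - (C * F + D * E) * q =
    C * (p - q * Y) - q * (C * (F - Y) + D * E) by ring.
  by apply: dvdp_sub; apply: dvdp_mull.
have /dvdXn_eq W22 : 'X^(N.*2) %| D * p - (C * G - D * F) * q.
  have -> : D * p - (C * G - D * F) * q =
    D * (p - q * Y) - q * (C * G - D * (F + Y)) by ring.
  by apply: dvdp_sub; apply: dvdp_mull.
have sNq (Z : {poly R}) : (size Z <= N.+2)%N -> (size (Z * q)%R <= N.*2)%N.
  move=> sZ; by rewrite N1; apply: size_mul_leqS.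
have sB2 (Z Z' : {poly R}) m : (size Z <= m)%N -> (size Z' <= m)%N ->
    (size (Z - Z')%R <= m)%N.
  move=> sZ sZ'; apply: leq_trans (size_polyD _ _) _.
  by rewrite geq_max size_polyN sZ.
have sD2 (Z Z' : {poly R}) m : (size Z <= m)%N -> (size Z' <= m)%N ->
    (size (Z + Z')%R <= m)%N.
  by move=> sZ sZ'; apply: leq_trans (size_polyD _ _) _; rewrite geq_max sZ.
have s1 : (size ((A * F + B * E) * q)%R <= N.*2)%N.
  by apply: sNq; apply: sD2; rewrite N4; apply: size_mul_leqS.
have s2 : (size ((C * G - D * F) * q)%R <= N.*2)%N.
  apply: sNq; apply: sB2; last by rewrite N4; apply: size_mul_leqS.
  have -> : N.+2 = (n.+1 + 2).+1 by rewrite /N addn2.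
  exact: size_mul_leqS.
have s3 : (size ((C * F + D * E) * q)%R <= N.*2)%N.
  apply: sNq; apply: sD2; last by rewrite N4; apply: size_mul_leqS.
  have -> : N.+2 = (n.+1 + 1).+2 by rewrite /N addn1.
  by apply: leqW; apply: size_mul_leqS.
have s4 : (size ((A * G - B * F) * q)%R <= (N.*2).+1)%N.
  rewrite N2; apply: size_mul_leqS => //; apply: sB2.
    by rewrite N5; apply: size_mul_leqS.
  by apply: leqW; rewrite N4; apply: size_mul_leqS.
(* The size bounds now leave only multiples of ['X^(2n)]: the top coefficient of [p] on the
   diagonal, 0 below it, and an unknown constant [w] above it. *)
have {}W11 : A * p - (A * F + B * E) * q = (p`_N)%:P * 'X^(N.*2).
  rewrite W11; last first.
    by apply: sB2; [rewrite -addnn; apply: size_mul_leqS | apply: leqW].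
  rewrite coefB [X in _ - X]nth_default // -addnn coef_mul_top //.
  by rewrite A1 mul1r subr0.
have {}W22 : D * p - (C * G - D * F) * q = (p`_N)%:P * 'X^(N.*2).
  rewrite W22; last first.
    by apply: sB2; [rewrite -addnn; apply: size_mul_leqS | apply: leqW].
  rewrite coefB [X in _ - X]nth_default // -addnn coef_mul_top //.
  by rewrite D1 mul1r subr0.
have {}W21 : C * p - (C * F + D * E) * q = 0.
  have s5 : (size (C * p - (C * F + D * E) * q)%R <= N.*2)%N.
    apply: sB2 => //; rewrite N3; exact: size_mul_leqS.
  by rewrite W21 ?nth_default ?mul0r // leqW.
have {}W12 : exists w, B * p - (A * G - B * F) * q = w%:P * 'X^(N.*2).
  eexists; apply: W12; apply: sB2 => //.
  by rewrite -addnn; apply: size_mul_leqS.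
have [w {}W12] := W12.
have Xinj (Z Z' : {poly R}) : Z * 'X^(N.*2) = Z' * 'X^(N.*2) -> Z = Z'.
  by apply: mulIf; rewrite monic_neq0 // monicXn.
(* Multiplying on the right by [p + q L] solves for [N], since [L^2 = Q] and [(p - q L) (p + q L)]
   is the left side of Pell's equation. *)
have EC : (c ^+ 2)%:P * C = (p`_N)%:P * (E * q).
  apply: Xinj; apply: (eq_of_lincomb (k := - C) pell).
  apply: (eq_of_lincomb (k := p + F * q) W21).
  by apply: (eq_of_lincomb (k := E * q) W22); rewrite -EP; ring.
have ED : (c ^+ 2)%:P * D = (p`_N)%:P * (p - F * q).
  apply: Xinj; apply: (eq_of_lincomb (k := - D) pell).
  apply: (eq_of_lincomb (k := G * q) W21).
  by apply: (eq_of_lincomb (k := p - F * q) W22); rewrite -EP; ring.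
have EA : (c ^+ 2)%:P * A = (p`_N)%:P * (p + F * q) + w%:P * (E * q).
  apply: Xinj; apply: (eq_of_lincomb (k := - A) pell).
  apply: (eq_of_lincomb (k := p + F * q) W11).
  by apply: (eq_of_lincomb (k := E * q) W12); rewrite -EP; ring.
have EB : (c ^+ 2)%:P * B = (p`_N)%:P * (G * q) + w%:P * (p - F * q).
  apply: Xinj; apply: (eq_of_lincomb (k := - B) pell).
  apply: (eq_of_lincomb (k := G * q) W11).
  by apply: (eq_of_lincomb (k := p - F * q) W12); rewrite -EP; ring.
have w0 : w = 0.
  have := congr1 (horner^~ 0) ED; have := congr1 (horner^~ 0) EB.
  rewrite !hornerS B0 G0 => HB HD.
  have : w * ((c ^+ 2) * D.[0]) = 0.
    apply: (eq_of_lincomb (k := w) HD).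
    by apply: (eq_of_lincomb (k := - p`_N) HB); ring.
  move/eqP; rewrite mulf_eq0 => /orP[/eqP //|].
  by rewrite mulf_eq0 expf_eq0 /= (negPf c0) (negPf D0).
by split=> //; rewrite ?EA ?EB w0 mul0r addr0.
Qed.

End PellUnique.

(** * The Lax representation of the billiard map *)

Section BilliardMap.
Variables (R : realFieldType) (a b l s : R).
Variables (x1 x2 u1 u2 t beta : nat -> R).

Definition cubic : {poly R} := (a%:P - 'X) * (b%:P - 'X) * (l%:P - 'X).

Definition epol (v1 v2 : R) : {poly R} :=
  (v1 ^+ 2)%:P * (b%:P - 'X) + (v2 ^+ 2)%:P * (a%:P - 'X).
Definition fpol (y1 y2 v1 v2 : R) : {poly R} :=
  (y1 * v1)%:P * (b%:P - 'X) + (y2 * v2)%:P * (a%:P - 'X).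
(** At a point of the ellipse the cleared form [g] vanishes at [z = 0]; this is its quotient by
    ['X]. *)
Definition hpol (y1 y2 : R) : {poly R} :=
  'X - (a + b - y1 ^+ 2 - y2 ^+ 2)%:P.

Let e k := epol (u1 k) (u2 k).
Let f k := fpol (x1 k) (x2 k) (u1 k) (u2 k).
Let h k := hpol (x1 k) (x2 k).
Let P := cubic.

Hypotheses (b_gt0 : 0 < b) (b_lt_a : b < a) (s_gt0 : 0 < s).
Hypothesis s2 : s ^+ 2 = a * b * l.
Hypothesis onE : forall k, x1 k ^+ 2 / a + x2 k ^+ 2 / b = 1.
Hypothesis unitE : forall k, u1 k ^+ 2 + u2 k ^+ 2 = 1.
Hypothesis causticE : forall k,
  u1 k ^+ 2 * (b - l) + u2 k ^+ 2 * (a - l) = (x1 k * u2 k - x2 k * u1 k) ^+ 2.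
Hypothesis t_gt0 : forall k, 0 < t k.
Hypothesis x1S : forall k, x1 k.+1 = x1 k + t k * u1 k.
Hypothesis x2S : forall k, x2 k.+1 = x2 k + t k * u2 k.
Hypothesis u1S : forall k, u1 k.+1 = u1 k + beta k * (x1 k.+1 / a).
Hypothesis u2S : forall k, u2 k.+1 = u2 k + beta k * (x2 k.+1 / b).

Let a_gt0 : 0 < a. Proof. exact: lt_trans b_lt_a. Qed.
Let a0 : a != 0. Proof. exact: lt0r_neq0. Qed.
Let b0 : b != 0. Proof. exact: lt0r_neq0. Qed.

Let onE' k : a * b - x1 k ^+ 2 * b - x2 k ^+ 2 * a = 0.
Proof.
have -> : a * b = a * b * (x1 k ^+ 2 / a + x2 k ^+ 2 / b) by rewrite onE mulr1.
by field; rewrite a0 b0.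
Qed.

Lemma hpolE k : 'X * h k = (a%:P - 'X) * (b%:P - 'X)
   - (x1 k ^+ 2)%:P * (b%:P - 'X) - (x2 k ^+ 2)%:P * (a%:P - 'X).
Proof.
apply: (eq_of_lincomb (k := -1) (congr1 polyC (onE' k))); rewrite /h /hpol; ring.
Qed.

(** By Lagrange's identity the left side is [(a - z) (b - z)] times the difference of [e(z)] and the
    squared angular momentum. The latter is [e(l)] by the caustic condition, and
    [e(z) - e(l) = l - z] for a unit velocity. *)
Lemma curveE k : f k ^+ 2 + e k * ('X * h k) = P.
Proof.
have H1 := congr1 polyC (unitE k); have H2 := congr1 polyC (causticE k).
rewrite hpolE /f /e /fpol /epol /P /cubic.
set D := (a%:P - 'X) * (b%:P - 'X).
apply: (eq_of_lincomb (k := D * (l%:P - 'X)) H1).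
apply: (eq_of_lincomb (k := D) H2); rewrite /D; ring.
Qed.

Lemma epol_gt0 k : 0 < (e k).[0].
Proof.
rewrite /e /epol !hornerS.
have := unitE k; have := sqr_ge0 (u1 k); have := sqr_ge0 (u2 k).
move: b_gt0 b_lt_a; set p := u1 k ^+ 2; set q := u2 k ^+ 2; nra.
Qed.

Lemma hpol_lt0 k : (h k).[0] < 0.
Proof.
rewrite /h /hpol !hornerS.
have := onE' k; have := sqr_ge0 (x1 k); have := sqr_ge0 (x2 k).
move: b_gt0 b_lt_a a_gt0; set p := x1 k ^+ 2; set q := x2 k ^+ 2.
move=> hb hab ha hq hp H.
suff: p + q <= a by lra.
rewrite -(ler_pM2r hb); nra.
Qed.


(** Joachimsthal's integral. Its square is the value of the cubic at 0. Its sign comes from both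
    ends of the chord lying on the ellipse: this gives [2 f(0) + t e(0) = 0], with [t] and [e(0)]
    positive. *)
Lemma fpol0 k : (f k).[0] = - s.
Proof.
have e0 := epol_gt0 k.
have /eqP : (f k).[0] ^+ 2 = s ^+ 2.
  have := congr1 (horner^~ 0) (curveE k).
  rewrite s2 /P /cubic !hornerS => H.
  by apply: (eq_of_lincomb (k := 1) H); ring.
rewrite eqf_sqr => /orP[/eqP fs|/eqP //].
have := onE' k.+1; have := onE' k; rewrite x1S x2S.
move: e0 fs; rewrite /e /f /epol /fpol !hornerS => e0 fs H0 H1.
have tp := t_gt0 k.
have : t k * (2 * s + t k * (u1 k ^+ 2 * b + u2 k ^+ 2 * a)) = 0.
  rewrite -fs; apply: (eq_of_lincomb (k := -1) H1).
  by apply: (eq_of_lincomb (k := 1) H0); ring.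
move/eqP; rewrite mulf_eq0 gt_eqF //= => /eqP H.
by have := mulr_gt0 tp e0; move: s_gt0; lra.
Qed.

(** This and the next two recurrences follow the entries of the Lax matrix through a flight of
    length [t] and a change of velocity by [beta] times the normal. *)
Lemma hpolS k : 'X * h k.+1 =
  'X * h k - (t k)%:P *+ 2 * f k - (t k ^+ 2)%:P * e k.
Proof. rewrite !hpolE x1S x2S /f /e /fpol /epol; ring. Qed.

Lemma fpolS k : f k.+1 = f k + (t k)%:P * e k - (beta k)%:P * h k.+1.
Proof.
have H := congr1 polyC (onE k.+1).
have H' : (x1 k.+1 * u1 k.+1)%:P =
    (x1 k.+1 * u1 k)%:P + (beta k)%:P * (x1 k.+1 ^+ 2 / a)%:P :> {poly R}.
  by rewrite u1S -!polyCM -polyCD; congr polyC; ring.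
have H'' : (x2 k.+1 * u2 k.+1)%:P =
    (x2 k.+1 * u2 k)%:P + (beta k)%:P * (x2 k.+1 ^+ 2 / b)%:P :> {poly R}.
  by rewrite u2S -!polyCM -polyCD; congr polyC; ring.
have Ha : a%:P * (x1 k.+1 ^+ 2 / a)%:P = (x1 k.+1 ^+ 2)%:P :> {poly R}.
  by rewrite -polyCM; congr polyC; field.
have Hb : b%:P * (x2 k.+1 ^+ 2 / b)%:P = (x2 k.+1 ^+ 2)%:P :> {poly R}.
  by rewrite -polyCM; congr polyC; field.
rewrite /f /fpol H' H'' /e /epol /h /hpol; move: H Ha Hb.
rewrite polyCD; set A := (_ / a)%:P; set B := (_ / b)%:P => H Ha Hb.
rewrite !polyCB -Ha -Hb.
apply: (eq_of_lincomb (k := (beta k)%:P * (a%:P + b%:P - 'X)) H).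
rewrite x1S x2S; ring.
Qed.

Lemma epolS k : 'X * e k.+1 =
  'X * e k + (beta k)%:P *+ 2 * (f k + (t k)%:P * e k)
  - (beta k ^+ 2)%:P * h k.+1.
Proof.
have Ef : f k + (t k)%:P * e k = fpol (x1 k.+1) (x2 k.+1) (u1 k) (u2 k).
  by rewrite x1S x2S /f /e /fpol /epol; ring.
have {1}-> : e k = epol (u1 k) (u2 k) by [].
rewrite Ef.
have := unitE k.+1; have := unitE k; have := onE k.+1.
rewrite /e u1S u2S /h.
have [n1 ->] : exists n1, x1 k.+1 = a * n1.
  by exists (x1 k.+1 / a); field.
have [n2 ->] : exists n2, x2 k.+1 = b * n2.
  by exists (x2 k.+1 / b); field.
have -> : (a * n1) / a = n1 by field.
have -> : (b * n2) / b = n2 by field.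
have -> : (a * n1) ^+ 2 / a = a * n1 ^+ 2 by field.
have -> : (b * n2) ^+ 2 / b = b * n2 ^+ 2 by field.
move=> /(congr1 polyC) H /(congr1 polyC) H1 /(congr1 polyC) H2.
rewrite /fpol /epol /hpol.
apply: (eq_of_lincomb (k := (beta k ^+ 2)%:P * (a%:P + b%:P - 'X)) H).
apply: (eq_of_lincomb (k := (a%:P - 'X) * (b%:P - 'X)) H1).
apply: (eq_of_lincomb (k := - (a%:P - 'X) * (b%:P - 'X)) H2).
ring.
Qed.

Lemma hpol_beta k : beta k * (h k.+1).[0] = 2 * s.
Proof.
have := congr1 (horner^~ 0) (fpolS k); have := congr1 (horner^~ 0) (hpolS k).
move: (fpol0 k) (fpol0 k.+1) (t_gt0 k); move: (f k) (f k.+1) (e k) (h k) (h k.+1).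
move=> F F' E H H' F0 F0' tp; rewrite !hornerS F0 F0' => H1 H2.
have : t k * (t k * E.[0] - 2 * s) = 0.
  by apply: (eq_of_lincomb (k := 1) H1); ring.
move/eqP; rewrite mulf_eq0 gt_eqF //= => /eqP Ht.
by move: H2; lra.
Qed.

Lemma epol_t k : t k * (e k).[0] = 2 * s.
Proof.
have := congr1 (horner^~ 0) (fpolS k).
move: (fpol0 k) (fpol0 k.+1) (hpol_beta k).
move: (f k) (f k.+1) (e k) (h k.+1) => F F' E H F0 F0' Hb.
rewrite !hornerS F0 F0'; lra.
Qed.

(* The transfer matrix of [k] bounces, cleared of denominators, acting on
   pairs; at [z = a] and [z = b] it is the billiard map itself on each pair
   (coordinate, velocity). *)
Fixpoint transfer (w : {poly R} * {poly R}) (k : nat) : {poly R} * {poly R} :=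
  if k is k'.+1 then
    let v := transfer w k' in
    let y := v.1 + (t k')%:P * v.2 in
    ('X * y, 'X * v.2 + (beta k')%:P * y)
  else w.

Lemma transfer_lin c d w v k :
  transfer (c * w.1 + d * v.1, c * w.2 + d * v.2) k =
  (c * (transfer w k).1 + d * (transfer v k).1,
   c * (transfer w k).2 + d * (transfer v k).2).
Proof. by elim: k => //= k ->/=; congr pair; ring. Qed.

Definition trA k := (transfer (1, 0) k).1.
Definition trB k := (transfer (0, 1) k).1.
Definition trC k := (transfer (1, 0) k).2.
Definition trD k := (transfer (0, 1) k).2.

Lemma transferE w k : transfer w k =
  (w.1 * trA k + w.2 * trB k, w.1 * trC k + w.2 * trD k).
Proof.
rewrite -transfer_lin; congr (transfer _ k).
by case: w => w1 w2 /=; congr pair; ring.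
Qed.

(** The intertwining relation [N L_0 = L_k N] applied to [w]: by the recurrences above, each bounce
    conjugates the Lax matrix. *)
Lemma transfer_lax w k :
  transfer (f 0 * w.1 + 'X * h 0 * w.2, e 0 * w.1 - f 0 * w.2) k =
  (f k * (transfer w k).1 + 'X * h k * (transfer w k).2,
   e k * (transfer w k).1 - f k * (transfer w k).2).
Proof.
elim: k => //= k ->/=; move: (transfer w k) => [v1 v2] /=.
congr pair.
  apply: (eq_of_lincomb (k := - 'X * (v1 + (t k)%:P * v2)) (fpolS k)).
  apply: (eq_of_lincomb (k := - 'X * v2) (hpolS k)); ring.
apply: (eq_of_lincomb (k := - (v1 + (t k)%:P * v2)) (epolS k)).
apply: (eq_of_lincomb
  (k := 'X * v2 + (beta k)%:P * (v1 + (t k)%:P * v2)) (fpolS k)).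
apply: (eq_of_lincomb (k := - (beta k)%:P * v2) (hpolS k)); ring.
Qed.


Lemma transfer_det k : trA k * trD k - trB k * trC k = 'X^(k.*2).
Proof.
rewrite /trA /trB /trC /trD; elim: k => [|k IH] /=.
  by rewrite expr0; ring.
by rewrite doubleS !exprS -IH; ring.
Qed.

Lemma size_transfer k :
  [/\ (size (trA k) <= k.+1)%N, (size (trB k) <= k.+1)%N,
      (size (trC k) <= k)%N & (size (trD k) <= k.+1)%N].
Proof.
have sz (p q : {poly R}) (c : R) m : (size p <= m)%N -> (size q <= m)%N ->
    (size (p + c%:P * q)%R <= m)%N.
  move=> pm qm; apply: leq_trans (size_polyD _ _) _; rewrite geq_max pm /=.
  by rewrite mul_polyC; apply: leq_trans (size_scale_leq _ _) qm.
have szX (p : {poly R}) m : (size p <= m)%N -> (size ('X * p)%R <= m.+1)%N.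
  move=> pm; have [->|p0] := eqVneq p 0; first by rewrite mulr0 size_poly0.
  by rewrite mulrC size_mulX.
elim: k => [|k [IA IB IC ID]].
  by rewrite /trA /trB /trC /trD /= size_poly0 size_poly1.
rewrite /trA /trB /trC /trD /= -/(trA k) -/(trB k) -/(trC k) -/(trD k).
split.
- by apply: szX; apply: (sz) => //; apply: leqW.
- by apply: szX; apply: (sz).
- by apply: (sz); [apply: szX | apply: (sz) => //; apply: leqW].
- by apply: (sz); [apply: szX | apply: leqW; apply: (sz)].
Qed.

Lemma coef_transfer k : (trA k)`_k = 1 /\ (trD k)`_k = 1.
Proof.
elim: k => [|k [IA ID]]; first by rewrite /trA /trD /= coef1.
have [sA sB sC sD] := size_transfer k.
rewrite /trA /trD /= -/(trA k) -/(trB k) -/(trC k) -/(trD k).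
rewrite !(coefXM, coefD, coefCM) /= IA ID; split.
  by rewrite (nth_default _ sC) mulr0 addr0.
by rewrite !nth_default // mulr0 addr0 mulr0 addr0.
Qed.

(** At 0 a bounce kills the first row and multiplies the lower right entry by [beta t]. This is
    negative, because [beta h(0) = 2 s] and [h(0) < 0]. *)
Lemma transfer_at0 k : [/\ (trA k.+1).[0] = 0, (trB k).[0] = 0
  & 0 < (-1) ^+ k * (trD k).[0]].
Proof.
have HB m : (trB m).[0] = 0.
  by case: m => [|m]; rewrite /trB /= !(hornerS, hornerXn, mul0r).
split=> //; first by rewrite /trA /= !hornerS mul0r.
elim: k => [|k IH]; first by rewrite /trD /= hornerC mulr1.
rewrite /trD /= -/(trB k) -/(trD k) !hornerS mul0r HB !add0r.
have -> : (-1) ^+ k.+1 * (beta k * (t k * (trD k).[0])) =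
  (- beta k * t k) * ((-1) ^+ k * (trD k).[0]) by rewrite exprS; ring.
rewrite mulr_gt0 // mulr_gt0 // oppr_gt0 -(nmulr_lgt0 _ (hpol_lt0 k.+1)).
by rewrite hpol_beta mulr_gt0.
Qed.

Lemma transfer_horner (y v : nat -> R) c k : c != 0 ->
  (forall k, y k.+1 = y k + t k * v k) ->
  (forall k, v k.+1 = v k + beta k * (y k.+1 / c)) ->
  (trA k).[c] * y 0 + (trB k).[c] * v 0 = c ^+ k * y k /\
  (trC k).[c] * y 0 + (trD k).[c] * v 0 = c ^+ k * v k.
Proof.
move=> c0 yS vS; elim: k => [|k [IH1 IH2]].
  by rewrite /trA /trB /trC /trD /= !hornerS; split; ring.
rewrite /trA /trB /trC /trD /= -/(trA k) -/(trB k) -/(trC k) -/(trD k).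
have H1 : ('X * (trA k + (t k)%:P * trC k)).[c] * y 0 +
    ('X * (trB k + (t k)%:P * trD k)).[c] * v 0 = c ^+ k.+1 * y k.+1.
  rewrite !hornerS yS exprS; apply: (eq_of_lincomb (k := c) IH1).
  by apply: (eq_of_lincomb (k := c * t k) IH2); ring.
split=> //; rewrite !hornerS vS exprS; move: H1; rewrite !hornerS exprS.
have [z ->] : exists z, y k.+1 = c * z by exists (y k.+1 / c); field.
rewrite (mulrC c z) mulfK // => H1.
apply: (mulfI c0); apply: (eq_of_lincomb (k := beta k) H1).
by apply: (eq_of_lincomb (k := c ^+ 2) IH2); ring.
Qed.

(* The eigenvector of the Lax matrix for the eigenvalue [- Y], [Y] a branch of
   the square root of the cubic, vanishes to order 2 at each bounce. *)
Lemma transfer_eigen (Y : {poly R}) w K k : Y.[0] = s -> (k.*2 < K)%N ->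
  'X^K %| (f 0 + Y) * w.1 + 'X * h 0 * w.2 ->
  'X^K %| e 0 * w.1 + (Y - f 0) * w.2 ->
  'X^(k.*2) %| (transfer w k).1 /\ 'X^(k.*2) %| (transfer w k).2.
Proof.
move=> Y0 + d1 d2.
have dv m : 'X^K %| (f m + Y) * (transfer w m).1 + 'X * h m * (transfer w m).2
    /\ 'X^K %| e m * (transfer w m).1 + (Y - f m) * (transfer w m).2.
  have H := transfer_lin 1 Y
    (f 0 * w.1 + 'X * h 0 * w.2, e 0 * w.1 - f 0 * w.2) w m.
  rewrite transfer_lax /= in H.
  have -> : (f m + Y) * (transfer w m).1 + 'X * h m * (transfer w m).2 =
    1 * (f m * (transfer w m).1 + 'X * h m * (transfer w m).2) +
    Y * (transfer w m).1 by ring.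
  have -> : e m * (transfer w m).1 + (Y - f m) * (transfer w m).2 =
    1 * (e m * (transfer w m).1 - f m * (transfer w m).2) +
    Y * (transfer w m).2 by ring.
  move: (congr1 fst H) (congr1 snd H) => /= <- <-.
  rewrite transferE /=; split; apply: dvdp_add; apply: dvdp_mulr.
  - by apply: etrans d1; congr (_ %| _); ring.
  - by apply: etrans d2; congr (_ %| _); ring.
  - by apply: etrans d1; congr (_ %| _); ring.
  - by apply: etrans d2; congr (_ %| _); ring.
elim: k => [|k IH]; rewrite ?doubleS => lt_kK; first by rewrite expr0 !dvd1p.
have [|] := IH; first exact: ltnW (ltnW lt_kK).
have := dv k; rewrite /=; move: (transfer w k) => [w1 w2] /=.
move=> [D1 D2] /dvdpP[v1 Ew1] /dvdpP[v2 Ew2].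
have X2 p : 'X^K %| p * 'X^(k.*2) -> 'X^2 %| p.
  move=> H; have : 'X^2 * 'X^(k.*2) %| p * 'X^(k.*2).
    by apply: dvdp_trans H; rewrite -exprD dvdp_exp2l // ltnW.
  by rewrite dvdp_mul2r // monic_neq0 // monicXn.
have {D1}D1 : 'X^2 %| (f k + Y) * v1 + 'X * h k * v2.
  by apply: X2; apply: etrans D1; rewrite Ew1 Ew2; congr (_ %| _); ring.
have {D2}D2 : 'X^2 %| e k * v1 + (Y - f k) * v2.
  by apply: X2; apply: etrans D2; rewrite Ew1 Ew2; congr (_ %| _); ring.
(* Since [t e(0) = 2 s], the second relation at 0 reads [e(0) (v1 + t v2) = 0]: the flight gains one
   zero. *)
have /dvdpP[y Ey] : 'X %| v1 + (t k)%:P * v2.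
  rewrite dvdp_X hornerS.
  have : 'X %| e k * v1 + (Y - f k) * v2.
    by apply: dvdp_trans D2; rewrite exprS dvdp_mulr.
  rewrite dvdp_X; have := fpol0 k; have := epol_t k; have := epol_gt0 k.
  move: (e k) (f k) => E F E0 Et F0; rewrite !hornerS F0 Y0.
  have -> : s = t k * E.[0] / 2 by rewrite Et; field.
  have -> : E.[0] * v1.[0] + (t k * E.[0] / 2 - - (t k * E.[0] / 2)) * v2.[0] =
    E.[0] * (v1.[0] + t k * v2.[0]) by field.
  by rewrite mulf_eq0 gt_eqF.
(* The first relation plus [t] times the second is divisible by ['X^2]. After one division by ['X],
   its value at 0 is [h(0) (v2 + beta y)], with [h] taken after the bounce: the reflection gains the
   second zero. *)
have : 'X %| v2 + (beta k)%:P * y.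
  have : 'X * 'X %| ((f k + (t k)%:P * e k + Y) * y + h k.+1 * v2) * 'X.
    have -> : ((f k + (t k)%:P * e k + Y) * y + h k.+1 * v2) * 'X =
        ((f k + Y) * v1 + 'X * h k * v2) +
        (t k)%:P * (e k * v1 + (Y - f k) * v2).
      apply: (eq_of_lincomb (k := - (f k + (t k)%:P * e k + Y)) Ey).
      by apply: (eq_of_lincomb (k := v2) (hpolS k)); ring.
    by apply: dvdp_add; rewrite -?expr2 // dvdp_mull.
  rewrite dvdp_mul2r ?polyX_eq0 // !dvdp_X.
  have := fpol0 k; have := epol_t k; have := hpol_beta k; have := hpol_lt0 k.+1.
  move: (h k.+1) (e k) (f k) => H E F H0 Hb Et F0; rewrite !hornerS F0 Y0 Et.
  have -> : (- s + 2 * s + s) * y.[0] + H.[0] * v2.[0] =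
      H.[0] * (v2.[0] + beta k * y.[0]).
    by rewrite mulrDr mulrA [H.[0] * beta k]mulrC Hb; ring.
  by rewrite mulf_eq0 lt_eqF.
move=> /dvdpP[z Ez].
have -> : w1 + (t k)%:P * w2 = y * 'X * 'X^(k.*2).
  by rewrite Ew1 Ew2 -Ey; ring.
rewrite Ew2; split; apply/dvdpP.
  by exists y; rewrite !exprS; ring.
by exists z; rewrite !exprS; apply: (eq_of_lincomb (k := 'X * 'X^(k.*2)) Ez); ring.
Qed.

(** * Sign changes of the coordinates and Pell's equation *)

Lemma horner_lax_a k :
  (f k).[a] = (b - a) * (x1 k * u1 k) /\ (e k).[a] = (b - a) * u1 k ^+ 2 /\
  ('X * h k).[a] = - ((b - a) * x1 k ^+ 2).
Proof.
by rewrite hpolE /f /e /fpol /epol !hornerS; do !split; ring.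
Qed.

Lemma horner_lax_b k :
  (f k).[b] = (a - b) * (x2 k * u2 k) /\ (e k).[b] = (a - b) * u2 k ^+ 2 /\
  ('X * h k).[b] = - ((a - b) * x2 k ^+ 2).
Proof.
by rewrite hpolE /f /e /fpol /epol !hornerS; do !split; ring.
Qed.

Lemma coord1_neq0 k : l != a -> (x1 k, u1 k) <> (0, 0).
Proof.
move=> /eqP lc [y0 v0]; apply: lc; have := unitE k; have := causticE k.
rewrite y0 v0 => H1 H2; apply: (eq_of_lincomb (k := a - l) H2).
by apply: (eq_of_lincomb (k := -1) H1); ring.
Qed.

Lemma coord2_neq0 k : l != b -> (x2 k, u2 k) <> (0, 0).
Proof.
move=> /eqP lc [y0 v0]; apply: lc; have := unitE k; have := causticE k.
rewrite y0 v0 => H1 H2; apply: (eq_of_lincomb (k := b - l) H2).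
by apply: (eq_of_lincomb (k := -1) H1); ring.
Qed.

Lemma cubic_simple z : l != a -> l != b -> P.[z] = 0 -> (deriv P).[z] != 0.
Proof.
move=> la lb; rewrite /P /cubic !poly.derivE !hornerS => /eqP.
rewrite !mulf_eq0 -orbA => /or3P[] /eqP H; apply/eqP.
- have -> : z = a by lra.
  move=> D0; have /eqP : (b - a) * (l - a) = 0.
    by apply: (eq_of_lincomb (k := -1) D0); ring.
  by rewrite mulf_eq0 !subr_eq0 (negPf la) lt_eqF.
- have -> : z = b by lra.
  move=> D0; have /eqP : (a - b) * (l - b) = 0.
    by apply: (eq_of_lincomb (k := -1) D0); ring.
  by rewrite mulf_eq0 !subr_eq0 (negPf lb) gt_eqF.
- have -> : z = l by lra.
  move=> D0; have /eqP : (a - l) * (b - l) = 0.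
    by apply: (eq_of_lincomb (k := -1) D0); ring.
  by rewrite mulf_eq0 !subr_eq0 ![_ == l]eq_sym (negPf la) (negPf lb).
Qed.

Lemma epolXE k : e k = (e k).[0]%:P - 'X.
Proof.
rewrite /e /epol !hornerS.
by apply: (eq_of_lincomb (k := - 'X) (congr1 polyC (unitE k))); ring.
Qed.

(** [N] commutes with a Lax matrix that has returned to its initial value, so it is [p + q L] with
    [q = C / E]. This quotient is a polynomial: if [C] did not vanish at the root of the linear [E],
    then [F] and [G] would vanish there, and [P] would have a double root. *)
Lemma transfer_commute n : l != a -> l != b ->
  e n = e 0 -> f n = f 0 -> h n = h 0 ->
  exists p q, [/\ trA n = p + f 0 * q, trB n = 'X * h 0 * q,
                  trC n = e 0 * q & trD n = p - f 0 * q].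
Proof.
move=> la lb en fn hn.
have := transfer_lax (1, 0) n; have := transfer_lax (0, 1) n.
rewrite en fn hn !transferE /=.
set A := trA n; set B := trB n; set C := trC n; set D := trD n.
set E := e 0; set F := f 0; set G := 'X * h 0.
rewrite !mulr0 !mulr1 !mul0r !mul1r !addr0 !add0r !subr0.
move=> [H1 H2] [H3 H4].
have dE : E %| C.
  have : E = E.[0]%:P - 'X := epolXE 0; move: E.[0] => r EX.
  rewrite EX -[_ - 'X]opprB dvdpNl dvdp_XsubCl.
  have EP : F ^+ 2 + E * G = P := curveE 0.
  clearbody E F G.
  have Er : E.[r] = 0 by rewrite EX !hornerS subrr.
  have /(congr1 (horner^~ r)) : F * C *+ 2 = E * (A - D).
    by apply: (eq_of_lincomb (k := 1) H4); ring.
  have /(congr1 (horner^~ r)) : G * C = E * B.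
    by apply: (eq_of_lincomb (k := -1) H3); ring.
  rewrite !(hornerMn, hornerM) Er !mul0r => /eqP + /eqP.
  rewrite mulrn_eq0 /= !mulf_eq0 -rootE => /orP[/eqP Gr|//] /orP[/eqP Fr|//].
  have : P.[r] = 0 by rewrite -EP !hornerS Fr Er; ring.
  move=> /cubic_simple -/(_ la lb) /eqP[].
  rewrite -EP expr2 !(derivD, derivM) !hornerS Fr Er Gr; ring.
have E0 : E != 0.
  by apply/eqP => EE; have := epol_gt0 0; rewrite -/E EE horner0 ltxx.
have /dvdpP[q Cq] := dE.
have HB : B = G * q.
  by apply: (mulfI E0); apply: (eq_of_lincomb (k := 1) H3); rewrite Cq; ring.
have HAD : A - D = F * q *+ 2.
  by apply: (mulfI E0); apply: (eq_of_lincomb (k := -1) H4); rewrite Cq; ring.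
have half : (2^-1)%:P * 2 = 1 :> {poly R}.
  have <- : (2 : R)%:P = 2 :> {poly R} by exact: polyC_natr.
  by rewrite -polyCM mulVf ?pnatr_eq0.
exists ((2^-1)%:P * (A + D)), q; split=> //.
- apply: (eq_of_lincomb (k := (2^-1)%:P) HAD).
  by apply: (eq_of_lincomb (k := F * q - A) half); ring.
- by rewrite Cq mulrC.
- apply: (eq_of_lincomb (k := -(2^-1)%:P) HAD).
  by apply: (eq_of_lincomb (k := - F * q - D) half); ring.
Qed.

(** Pell's equation is the determinant of [N = p + q L], and [p] is half the trace of [N], which
    yields its top coefficient and its sign at 0. *)
Lemma pell_of_sign n (c1 c2 : R) : l != a -> l != b -> (0 < n)%N ->
  c1 ^+ 2 = 1 -> c2 ^+ 2 = 1 ->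
  x1 n = c1 * x1 0 -> u1 n = c1 * u1 0 ->
  x2 n = c2 * x2 0 -> u2 n = c2 * u2 0 ->
  exists p q, [/\ p ^+ 2 - q ^+ 2 * P = 'X^(n.*2),
    (size p <= n.+1)%N /\ p`_n = 1, 0 < (-1) ^+ n * p.[0],
    p.[a] = c1 * a ^+ n & p.[b] = c2 * b ^+ n].
Proof.
move=> la lb n_gt0 c11 c22 x1n u1n x2n u2n.
have en : e n = e 0.
  by rewrite /e u1n u2n /epol !exprMn c11 c22 !mul1r.
have fn : f n = f 0.
  rewrite /f x1n u1n x2n u2n /fpol.
  have -> : c1 * x1 0 * (c1 * u1 0) = x1 0 * u1 0.
    by apply: (eq_of_lincomb (k := x1 0 * u1 0) c11); ring.
  have -> // : c2 * x2 0 * (c2 * u2 0) = x2 0 * u2 0.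
  by apply: (eq_of_lincomb (k := x2 0 * u2 0) c22); ring.
have hn : h n = h 0.
  by rewrite /h x1n x2n /hpol !exprMn c11 c22 !mul1r.
have [p [q [EA EB EC ED]]] := transfer_commute la lb en fn hn.
have [A1 D1] := coef_transfer n; have [sA _ _ sD] := size_transfer n.
have half : (2^-1)%:P * 2 = 1 :> {poly R}.
  have <- : (2 : R)%:P = 2 :> {poly R} by exact: polyC_natr.
  by rewrite -polyCM mulVf ?pnatr_eq0.
have Ep : p = (2^-1)%:P * (trA n + trD n).
  by rewrite EA ED; apply: (eq_of_lincomb (k := - p) half); ring.
exists p, q; split.
- rewrite -transfer_det EA EB EC ED -(curveE 0); ring.
- split; last by rewrite Ep coefCM coefD A1 D1; field.
  rewrite Ep mul_polyC; apply: leq_trans (size_scale_leq _ _) _.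
  by apply: leq_trans (size_polyD _ _) _; rewrite geq_max sA sD.
- case: n {x1n u1n x2n u2n en fn hn EA EB EC ED A1 D1 sA sD} n_gt0 Ep => // n _.
  have [A0 _ _] := transfer_at0 n; have [_ _ D0] := transfer_at0 n.+1.
  move=> ->; rewrite hornerM hornerC hornerD A0 add0r mulrCA.
  by rewrite mulr_gt0 // invr_gt0.
(* At [z = a] the Lax matrix is nilpotent and kills the nonzero vector [(x1, u1)], so [N] multiplies
   this vector by [p(a)]. The same holds at [z = b] for [(x2, u2)]. *)
- have [H1 H2] := transfer_horner n a0 x1S u1S.
  have [Fa [Ea Ga]] := horner_lax_a 0.
  have Z : (x1 0 != 0) || (u1 0 != 0).
    apply: contraT; rewrite negb_or !negbK => /andP[/eqP z1 /eqP z2].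
    by case: (coord1_neq0 (k := 0) la); rewrite z1 z2.
  move: Fa Ea Ga H1 H2; rewrite EA EB EC ED x1n u1n.
  move: (f 0) (e 0) ('X * h 0) => F E G Fa Ea Ga.
  rewrite !hornerS Fa Ea Ga => H1 H2.
  case/orP: Z => Z; apply: (mulIf Z).
    by apply: (eq_of_lincomb (k := 1) H1); ring.
  by apply: (eq_of_lincomb (k := 1) H2); ring.
- have [H1 H2] := transfer_horner n b0 x2S u2S.
  have [Fa [Ea Ga]] := horner_lax_b 0.
  have Z : (x2 0 != 0) || (u2 0 != 0).
    apply: contraT; rewrite negb_or !negbK => /andP[/eqP z1 /eqP z2].
    by case: (coord2_neq0 (k := 0) lb); rewrite z1 z2.
  move: Fa Ea Ga H1 H2; rewrite EA EB EC ED x2n u2n.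
  move: (f 0) (e 0) ('X * h 0) => F E G Fa Ea Ga.
  rewrite !hornerS Fa Ea Ga => H1 H2.
  case/orP: Z => Z; apply: (mulIf Z).
    by apply: (eq_of_lincomb (k := 1) H1); ring.
  by apply: (eq_of_lincomb (k := 1) H2); ring.
Qed.

Lemma transfer_of_pell n (p q Y : {poly R}) (c : R) : (1 < n)%N ->
  Y.[0] = s -> 'X^(n.*2.+1) %| P - Y ^+ 2 ->
  'X^(n.*2) %| p - q * Y -> p ^+ 2 - q ^+ 2 * P = (c ^+ 2)%:P * 'X^(n.*2) ->
  (size p <= n.+1)%N -> (size q <= n.-1)%N -> p`_n ^+ 2 = c ^+ 2 -> c != 0 ->
  [/\ (c ^+ 2)%:P * trA n = (p`_n)%:P * (p + f 0 * q),
      (c ^+ 2)%:P * trB n = (p`_n)%:P * ('X * h 0 * q),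
      (c ^+ 2)%:P * trC n = (p`_n)%:P * (e 0 * q) &
      (c ^+ 2)%:P * trD n = (p`_n)%:P * (p - f 0 * q)].
Proof.
move=> n1 Y0 dY dpq pell sp sq pn c0.
have [sA sB sC sD] := size_transfer n; have [A1 D1] := coef_transfer n.
(* Modulo [P - Y^2], both vectors [(f - Y, e)] and [(g, - (f + Y))] are eigenvectors of the Lax
   matrix for the eigenvalue [- Y]. *)
have := transfer_eigen (w := (f 0 - Y, e 0)) Y0 (ltnSn n.*2).
have := transfer_eigen (w := ('X * h 0, - (f 0 + Y))) Y0 (ltnSn n.*2).
have [_ B0] := transfer_at0 n.
have [-> | D0 _] := eqVneq (trD n).[0] 0; first by rewrite mulr0 ltxx.
have A0 : (trA n).[0] = 0.
  case: n n1 {sp sq dY dpq pell pn sA sB sC sD A1 D1 B0 D0} => // n _.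
  by case: (transfer_at0 n).
have EP := curveE 0; rewrite !transferE /=.
have sF : (size (f 0) <= 2)%N.
  rewrite /f /fpol; apply: leq_trans (size_polyD _ _) _.
  have sz (z w : R) : (size (z%:P * (w%:P - 'X))%R <= 2)%N.
    rewrite mul_polyC; apply: leq_trans (size_scale_leq _ _) _.
    by rewrite -opprB size_polyN size_XsubC.
  by rewrite geq_max !sz.
have sE : (size (e 0) <= 2)%N.
  by rewrite epolXE -opprB size_polyN size_XsubC.
have sG : (size ('X * h 0)%R <= 3)%N.
  rewrite mulrC; apply: leq_trans (size_polyMleq _ _) _.
  by rewrite size_polyX size_XsubC.
have G0 : ('X * h 0).[0] = 0 by rewrite hornerM hornerX mul0r.
move: ('X * h 0) (f 0) (e 0) (trA n) (trB n) (trC n) (trD n) P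
  A1 D1 sA sB sC sD sF sE sG A0 B0 D0 G0 EP dY pell.
move=> G F E A B C D Q A1 D1 sA sB sC sD sF sE sG A0 B0 D0 G0 EP dY pell.
case.
- by apply: etrans (dvdp0 'X^(n.*2.+1)); congr (_ %| _); ring.
- by apply: etrans dY; congr (_ %| _); rewrite -EP; ring.
rewrite !mulNr ![G * _]mulrC ![(F + Y) * _]mulrC => kB kD; case.
- by apply: etrans dY; congr (_ %| _); rewrite -EP; ring.
- by apply: etrans (dvdp0 'X^(n.*2.+1)); congr (_ %| _); ring.
rewrite ![(F - Y) * _]mulrC ![E * _]mulrC => kA kC.
rewrite [q * G]mulrC [q * E]mulrC.
apply: (pell_unique n1 sA sB sC sD A1 D1 sF sE sG A0 B0 D0 G0 EP) => //.
- exact: kA.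
- exact: kC.
- exact: kB.
- exact: kD.
- exact: dpq.
Qed.

Lemma sign_of_pell n (p q Y : {poly R}) (c d1 d2 : R) : (1 < n)%N ->
  Y.[0] = s -> 'X^(n.*2.+1) %| P - Y ^+ 2 ->
  'X^(n.*2) %| p - q * Y -> p ^+ 2 - q ^+ 2 * P = (c ^+ 2)%:P * 'X^(n.*2) ->
  (size p <= n.+1)%N -> (size q <= n.-1)%N -> p`_n ^+ 2 = c ^+ 2 -> c != 0 ->
  p.[a] = d1 * a ^+ n -> p.[b] = d2 * b ^+ n ->
  [/\ x1 n = p`_n * d1 / c ^+ 2 * x1 0, u1 n = p`_n * d1 / c ^+ 2 * u1 0,
      x2 n = p`_n * d2 / c ^+ 2 * x2 0 & u2 n = p`_n * d2 / c ^+ 2 * u2 0].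
Proof.
move=> n1 Y0 dY dpq pell sp sq pn c0 pa pb.
have [EA EB EC ED] := transfer_of_pell n1 Y0 dY dpq pell sp sq pn c0.
have [H1 H2] := transfer_horner n a0 x1S u1S.
have [H3 H4] := transfer_horner n b0 x2S u2S.
have := horner_lax_a 0; have := horner_lax_b 0; move: EA EB EC ED.
move: (f 0) (e 0) ('X * h 0) => F E G.
move=> EA EB EC ED [Fb [Eb Gb]] [Fa [Ea Ga]].
have va Z W : (c ^+ 2)%:P * Z = W -> c ^+ 2 * Z.[a] = W.[a].
  by move=> /(congr1 (horner^~ a)); rewrite hornerM hornerC.
have vb Z W : (c ^+ 2)%:P * Z = W -> c ^+ 2 * Z.[b] = W.[b].
  by move=> /(congr1 (horner^~ b)); rewrite hornerM hornerC.
move: (va _ _ EA) (va _ _ EB) (va _ _ EC) (va _ _ ED).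
move: (vb _ _ EA) (vb _ _ EB) (vb _ _ EC) (vb _ _ ED).
rewrite !hornerS pa pb Fa Ea Ga Fb Eb Gb.
set k := p`_n => Ab Bb Cb Db Aa Ba Ca Da.
have an0 : a ^+ n != 0 by rewrite expf_neq0.
have bn0 : b ^+ n != 0 by rewrite expf_neq0.
have cc0 : c ^+ 2 != 0 by rewrite expf_neq0.
have can z w y d : z != 0 -> c ^+ 2 * (z * w) = k * (d * z) * y ->
    w = k * d / c ^+ 2 * y.
  move=> z0 H; apply: (mulfI (mulf_neq0 cc0 z0)); rewrite -mulrA H.
  by field.
split.
- apply: (can _ _ _ _ an0); rewrite -H1.
  apply: (eq_of_lincomb (k := x1 0) Aa).
  by apply: (eq_of_lincomb (k := u1 0) Ba); ring.
- apply: (can _ _ _ _ an0); rewrite -H2.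
  apply: (eq_of_lincomb (k := x1 0) Ca).
  by apply: (eq_of_lincomb (k := u1 0) Da); ring.
- apply: (can _ _ _ _ bn0); rewrite -H3.
  apply: (eq_of_lincomb (k := x2 0) Ab).
  by apply: (eq_of_lincomb (k := u2 0) Bb); ring.
- apply: (can _ _ _ _ bn0); rewrite -H4.
  apply: (eq_of_lincomb (k := x2 0) Cb).
  by apply: (eq_of_lincomb (k := u2 0) Db); ring.
Qed.

(** The booleans record which factor vanishes at [a] and at [b]. As [f' r^2 - g' v^2 = c z^n], the
    sum [p] of the two terms equals [- c z^n] at a root of [f'] and [c z^n] at a root of [g']; [sg]
    is the sign of the top coefficient of [p] relative to [c]. *)
Lemma sign_of_split n (f' g' Y : {poly R}) (z1 z2 : bool) : (1 < n)%N ->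
  f' * g' = P -> f'.[0] != 0 -> odd (size f' + size g') ->
  (size f' + (n - n./2).*2 <= n.+3)%N -> (size g' + n./2.*2 <= n.+3)%N ->
  Y.[0] = s -> 'X^(n.*2.+1) %| P - Y ^+ 2 -> split_at0 n f' Y ->
  (if z1 then f' else g').[a] = 0 -> (if z2 then f' else g').[b] = 0 ->
  let sg := if odd (n + size f') then 1 else -1 in
  [/\ x1 n = sg * (-1) ^+ z1 * x1 0, u1 n = sg * (-1) ^+ z1 * u1 0,
      x2 n = sg * (-1) ^+ z2 * x2 0 & u2 n = sg * (-1) ^+ z2 * u2 0].
Proof.
move=> n1 fgP f0 oddfg szf szg Y0 dY [r [v [v0 szv szr dv]]] fa fb sg.
have g0 : g' != 0.
  apply/eqP => g0; have := fpol0 0; have := congr1 (horner^~ 0) (curveE 0).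
  rewrite -fgP g0 mulr0 horner0; move: (f 0) (e 0) (h 0) => F E H.
  rewrite !hornerS mul0r mulr0 addr0 => /eqP; rewrite mulf_eq0 orbb => /eqP ->.
  by move/eqP; rewrite eq_sym oppr_eq0 gt_eqF.
have arith i j k : (i + j.*2 <= n.+3 -> 0 < k <= j -> i + k.-1.*2 <= n.+1)%N.
  by clear; lia.
have arith' i k : (i <= n - n./2 -> k <= n./2 -> (i + k).-1 <= n.-1)%N.
  by clear; lia.
have szP (w z : {poly R}) j : (size w + j.*2 <= n.+3)%N -> (size z <= j)%N ->
    (size (w * z ^+ 2)%R <= n.+1)%N.
  have [->|z0] := eqVneq z 0; first by rewrite expr0n mulr0 size_poly0.
  move=> sw sz; apply: leq_trans (size_polyMleq _ _) _; rewrite size_sqr //.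
  by rewrite addnS /=; apply: arith sw _; rewrite size_poly_gt0 z0.
have dY' : 'X^(n.*2) %| P - Y ^+ 2.
  by apply: dvdp_trans dY; rewrite dvdp_exp2l.
have sfr : (size (f' * r ^+ 2)%R <= n.+1)%N by apply: szP szr.
have svg : (size (v ^+ 2 * g')%R <= n.+1)%N by rewrite mulrC; apply: szP szv.
have := pell_of_split fgP f0 dY' dv v0 g0 oddfg sfr svg.
move=> [c []]; set p := f' * r ^+ 2 + v ^+ 2 * g'; set q := - (r * v *+ 2).
move=> -[Ec c0] pell dpq szp pn.
have szq : (size q <= n.-1)%N.
  rewrite size_polyN -(@scaler_nat R); apply: leq_trans (size_scale_leq _ _) _.
  apply: leq_trans (size_polyMleq _ _) _.
  exact: arith'.
have val z (w : bool) : (if w then f' else g').[z] = 0 ->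
    p.[z] = ((-1) ^+ w * c) * z ^+ n.
  move=> w0; have := congr1 (horner^~ z) Ec; rewrite /p.
  rewrite !hornerD !hornerN !hornerM !horner_exp hornerC hornerX.
  case: w w0 => -> H; rewrite ?expr1 ?expr0; last first.
    by apply: (eq_of_lincomb (k := 1) H); ring.
  by apply: (eq_of_lincomb (k := -1) H); ring.
have pn2 : p`_n ^+ 2 = c ^+ 2 by rewrite pn; case: ifP; rewrite ?sqrrN.
have sgE (w : bool) : p`_n * ((-1) ^+ w * c) / c ^+ 2 = sg * (-1) ^+ w.
  by rewrite pn /sg; case: ifP => _; field.
have := sign_of_pell n1 Y0 dY dpq pell szp szq pn2 c0 (val _ _ fa) (val _ _ fb).
by rewrite !sgE.
Qed.

(** By [epol_t] and [hpol_beta], [t] and [beta] are determined by [e(0)] and [h(0)], which involve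
    only squares of velocities and positions. Hence the image of the orbit under the sign changes
    obeys the same recurrences. *)
Lemma sign_propagate n c1 c2 : c1 ^+ 2 = 1 -> c2 ^+ 2 = 1 ->
  x1 n = c1 * x1 0 -> u1 n = c1 * u1 0 ->
  x2 n = c2 * x2 0 -> u2 n = c2 * u2 0 -> forall k,
  [/\ x1 (k + n)%N = c1 * x1 k, u1 (k + n)%N = c1 * u1 k,
      x2 (k + n)%N = c2 * x2 k & u2 (k + n)%N = c2 * u2 k].
Proof.
move=> c11 c22 h1 h2 h3 h4; elim=> [|k [k1 k2 k3 k4]]; first by split.
have et : t (k + n)%N = t k.
  have e0 : (e k).[0] != 0 by rewrite gt_eqF // epol_gt0.
  apply: (mulIf e0); rewrite epol_t -(epol_t (k + n)) /e k2 k4 /epol.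
  by rewrite !exprMn c11 c22 !mul1r.
have y1 : x1 (k + n).+1 = c1 * x1 k.+1.
  by rewrite !x1S et k1 k2; ring.
have y2 : x2 (k + n).+1 = c2 * x2 k.+1.
  by rewrite !x2S et k3 k4; ring.
have eb : beta (k + n)%N = beta k.
  have h0 : (h k.+1).[0] != 0 by rewrite lt_eqF // hpol_lt0.
  apply: (mulIf h0); rewrite hpol_beta -(hpol_beta (k + n)) /h y1 y2 /hpol.
  by rewrite !exprMn c11 c22 !mul1r.
rewrite addSn; split=> //.
  by rewrite !u1S eb y1 k2; ring.
by rewrite !u2S eb y2 k4; ring.
Qed.

End BilliardMap.

(** * The signs of a solution of Pell's equation *)

Section Classification.
Variables (R : rcfType) (a b l : R).
Hypotheses (b_gt0 : 0 < b) (b_lt_a : b < a) (l_gt0 : 0 < l).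
Let P := cubic a b l.

(** The polynomials [p + d z^n] and [p - d z^n] are coprime: their difference is a constant times
    [z^n], and [p] is nonzero at 0. Hence [U] and [V] are coprime, and cancelling [f g] in Pell's
    equation gives [U V = q^2]. *)
Lemma split_of_factors n (f g U V p q Y : {poly R}) (d : R) : (0 < n)%N ->
  f * U = p + d%:P * 'X^n -> g * V = p - d%:P * 'X^n -> d ^+ 2 = 1 ->
  p ^+ 2 - q ^+ 2 * (f * g) = 'X^(n.*2) -> p.[0] != 0 -> (size p <= n.+1)%N ->
  'X^n %| f * g - Y ^+ 2 ->
  (n.+2 <= size f + (n - n./2).*2)%N -> (n.+2 <= size g + n./2.*2)%N ->
  split_at0 n f Y.
Proof.
move=> n0 EU EV d1 pell p0 sp dY szf szg.
have d0 : d != 0 by rewrite -sqrf_eq0 d1 oner_neq0.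
have x0 : ('X^n : {poly R}).[0] = 0 by rewrite hornerXn expr0n gtn_eqF.
have fU0 : f.[0] * U.[0] = p.[0].
  by rewrite -hornerM EU hornerD hornerM x0 mulr0 addr0.
have gV0 : g.[0] * V.[0] = p.[0].
  by rewrite -hornerM EV hornerD hornerN hornerM x0 mulr0 subr0.
have [f0 U0] : f.[0] != 0 /\ U.[0] != 0.
  by apply/andP; rewrite -negb_or -mulf_eq0 fU0.
have [g0 V0] : g.[0] != 0 /\ V.[0] != 0.
  by apply/andP; rewrite -negb_or -mulf_eq0 gV0.
have nz (w : {poly R}) : w.[0] != 0 -> w != 0.
  by apply: contra_neq => ->; rewrite horner0.
have UV : U * V = q ^+ 2.
  apply: (mulfI (mulf_neq0 (nz _ f0) (nz _ g0))).
  have d1P := congr1 polyC d1; rewrite polyC_exp in d1P.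
  apply: (eq_of_lincomb (k := g * V) EU).
  apply: (eq_of_lincomb (k := p + d%:P * 'X^n) EV).
  apply: (eq_of_lincomb (k := 1) pell).
  by apply: (eq_of_lincomb (k := - 'X^n ^+ 2) d1P); rewrite -muln2 exprM; ring.
have cop : coprimep U V.
  have : coprimep (f * U) (g * V).
    rewrite EV (_ : _ - _ = 1 * (f * U) + (- (d *+ 2))%:P * 'X^n).
      rewrite coprimep_addl_mul mul_polyC coprimepZr.
        by rewrite coprimep_Xn // hornerM fU0.
      by rewrite oppr_eq0 mulrn_eq0.
    by rewrite EU; ring.
  by rewrite coprimepMl => /andP[_]; rewrite coprimepMr => /andP[_].
have szle (F W : {poly R}) i : F.[0] != 0 -> W.[0] != 0 ->
    (size (F * W)%R <= n.+1)%N -> (n.+2 <= size F + i)%N -> (size W <= i)%N.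
  move=> F0 W0; rewrite size_mul ?nz //.
  have : (0 < size F)%N by rewrite size_poly_gt0 nz.
  by move: (size F) (size W) => j k; clear; lia.
have sX (e : R) : (size (p + e%:P * 'X^n)%R <= n.+1)%N.
  apply: leq_trans (size_polyD _ _) _; rewrite geq_max sp /= mul_polyC.
  by apply: leq_trans (size_scale_leq _ _) _; rewrite size_polyXn.
apply: (@split_of_pell _ n n./2 f g U V q Y (d *+ 2)) => //.
- by rewrite EU EV; ring.
- by apply: szle szg; rewrite // EV -mulNr -polyCN.
- by apply: szle szf; rewrite // EU.
Qed.

Lemma root_factor (p : {poly R}) z : p.[z] = 0 -> exists w, p = (z%:P - 'X) * w.
Proof.
move=> pz; have /factor_theorem[w ->] : root p z by apply/eqP.
by exists (- w); ring.
Qed.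

Lemma root_factor2 (p : {poly R}) z1 z2 : z1 != z2 ->
  p.[z1] = 0 -> p.[z2] = 0 -> exists w, p = (z1%:P - 'X) * (z2%:P - 'X) * w.
Proof.
move=> z12 /root_factor[w ->]; rewrite !hornerS => /eqP.
rewrite mulf_eq0 subr_eq0 (negPf z12) /= => /eqP/root_factor[v ->].
by exists v; ring.
Qed.

Lemma size_factor2 (z1 z2 : R) :
  size ((z1%:P - 'X) * (z2%:P - 'X) : {poly R}) = 3%N.
Proof.
have sz (z : R) : size (z%:P - 'X : {poly R}) = 2%N.
  by rewrite -opprB size_polyN size_XsubC.
by rewrite size_mul ?sz // -size_poly_eq0 sz.
Qed.

Variables (n : nat) (p q Y : {poly R}) (c1 c2 : R).
Hypotheses (n_gt1 : (1 < n)%N) (pell : p ^+ 2 - q ^+ 2 * P = 'X^(n.*2))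
  (sp : (size p <= n.+1)%N) (p0 : 0 < (-1) ^+ n * p.[0])
  (c11 : c1 ^+ 2 = 1) (c22 : c2 ^+ 2 = 1)
  (pa : p.[a] = c1 * a ^+ n) (pb : p.[b] = c2 * b ^+ n)
  (dY : 'X^n %| P - Y ^+ 2).

Let p00 : p.[0] != 0.
Proof. by apply: contraTneq p0 => ->; rewrite mulr0 ltxx. Qed.

Let pell_at z : p.[z] ^+ 2 = (z ^+ n) ^+ 2 + q.[z] ^+ 2 * P.[z].
Proof.
have := congr1 (horner^~ z) pell; rewrite hornerXn -muln2 exprM.
by rewrite !(hornerD, hornerN, hornerM) => <-; ring.
Qed.

Let p_neq0 z : 0 <= z -> 0 <= P.[z] -> p.[z] != 0.
Proof.
rewrite le_eqVlt => /orP[/eqP <- //|z0 Pz]; rewrite -sqrf_eq0 pell_at.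
rewrite gt_eqF //; apply: ltr_wpDr; first by rewrite mulr_ge0 ?sqr_ge0.
by rewrite exprn_gt0 // exprn_gt0.
Qed.

Let PE z : P.[z] = (a - z) * (b - z) * (l - z).
Proof. by rewrite /P /cubic !hornerS. Qed.

Let sign_eq (u v c d : R) : 0 < u -> 0 < v -> c ^+ 2 = 1 -> d ^+ 2 = 1 ->
  0 < (c * u) * (d * v) -> c = d.
Proof.
move=> u0 v0 /eqP + /eqP.
rewrite !sqrf_eq1 => /orP[]/eqP-> /orP[]/eqP-> //.
  by have := mulr_gt0 u0 v0; nra.
by have := mulr_gt0 u0 v0; nra.
Qed.

(* By Pell's equation [p] has no zero on an interval of positive numbers where
   the cubic is nonnegative. *)
Lemma sign_at_first z c : 0 < z -> z <= b -> z <= l ->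
  c ^+ 2 = 1 -> p.[z] = c * z ^+ n -> c = (-1) ^+ n.
Proof.
move=> z0 zb zl c1' pz; have sg : ((-1) ^+ n) ^+ 2 = 1 :> R by rewrite sqrr_sign.
have : 0 < p.[0] * p.[z].
  apply: sign_ivt => [|x /andP[x0 xz]]; first exact: ltW.
  by apply: p_neq0; rewrite // PE !mulr_ge0 // subr_ge0;
    move: b_lt_a zb zl xz; lra.
have -> : p.[0] = (-1) ^+ n * ((-1) ^+ n * p.[0]).
  by rewrite mulrA -expr2 sg mul1r.
rewrite pz => H.
by apply: esym; apply: sign_eq p0 (exprn_gt0 n z0) sg c1' H.
Qed.

(** Between the larger of [b], [l] and [a], two factors of the cubic are nonpositive and the third
    is nonnegative. *)
Lemma sign_at_last z c : 0 < z -> b <= z -> l <= z -> z <= a ->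
  c ^+ 2 = 1 -> p.[z] = c * z ^+ n -> c = c1.
Proof.
move=> z0 zb zl za c1' pz; have : 0 < p.[z] * p.[a].
  apply: sign_ivt => // x /andP[x0 xz]; apply: p_neq0.
    by apply: le_trans x0; exact: ltW.
  rewrite PE -mulrA mulr_ge0 ?subr_ge0 // mulr_le0 // subr_le0.
    exact: le_trans x0.
  exact: le_trans x0.
have a0 : 0 < a by apply: lt_trans b_lt_a.
rewrite pz pa => H.
by apply: sign_eq (exprn_gt0 n z0) (exprn_gt0 n a0) c1' c11 H.
Qed.

Lemma sign_l : exists2 c3, c3 ^+ 2 = 1 & p.[l] = c3 * l ^+ n.
Proof.
have ln0 : l ^+ n != 0 by rewrite expf_neq0 // gt_eqF.
exists (p.[l] / l ^+ n); last by rewrite divfK.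
by rewrite expr_div_n pell_at PE subrr mulr0 mulr0 addr0 mulfV // expf_neq0.
Qed.

Let dY' (f g : {poly R}) : f * g = P -> 'X^n %| f * g - Y ^+ 2.
Proof. by move->. Qed.

Let n_gt0 : (0 < n)%N. Proof. exact: ltnW. Qed.

Let size_lin (z : R) : size (z%:P - 'X : {poly R}) = 2%N.
Proof. by rewrite -opprB size_polyN size_XsubC. Qed.

Let size_cubic : size P = 4%N.
Proof.
rewrite /P /cubic size_mul ?size_factor2 ?size_lin //.
  by rewrite -size_poly_eq0 size_factor2.
by rewrite -size_poly_eq0 size_lin.
Qed.

(* The roots of the cubic are distributed over the coprime factors of
   [(p - d z^n) (p + d z^n) = q^2 P]. *)
Lemma split_lin z1 z2 z3 (d : R) :
  P = (z1%:P - 'X) * ((z2%:P - 'X) * (z3%:P - 'X)) ->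
  z2 != z3 -> d ^+ 2 = 1 -> p.[z1] = d * z1 ^+ n ->
  p.[z2] = - d * z2 ^+ n -> p.[z3] = - d * z3 ^+ n ->
  split_at0 n (z1%:P - 'X) Y.
Proof.
move=> PZ z23 d1 p1 p2 p3.
have [U EU] : exists U, p + (- d)%:P * 'X^n = (z1%:P - 'X) * U.
  by apply: root_factor; rewrite !hornerE p1; ring.
have [V EV] : exists V, p - (- d)%:P * 'X^n = (z2%:P - 'X) * (z3%:P - 'X) * V.
  by apply: root_factor2; rewrite // !hornerE ?p2 ?p3; ring.
apply: (split_of_factors (p := p) (q := q) n_gt0 (esym EU) (esym EV)) => //.
- by rewrite sqrrN.
- by rewrite -PZ.
- exact: dY'.
- by rewrite size_lin -[in X in (X <= _)%N](odd_double_half n); lia.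
- by rewrite size_factor2 -[in X in (X <= _)%N](odd_double_half n); lia.
Qed.

(** All three roots of the cubic go to the same factor. With [f = 1] and [g = P], the degree bounds
    hold because [n] is odd. *)
Lemma split_one : odd n -> l != a -> l != b ->
  p.[a] = - a ^+ n -> p.[b] = - b ^+ n -> p.[l] = - l ^+ n -> split_at0 n 1 Y.
Proof.
move=> on la lb p1 p2 p3.
have [V EV] : exists V, p - (-1)%:P * 'X^n = P * V.
  have [] := @root_factor2 (p - (-1)%:P * 'X^n) a b.
  - by rewrite gt_eqF.
  - by rewrite !hornerE p1; ring.
  - by rewrite !hornerE p2; ring.
  move=> W EW; have := congr1 (horner^~ l) EW.
  rewrite !hornerE p3 mulN1r opprK addNr => /esym/eqP.
  rewrite !mulf_eq0 !subr_eq0 ![_ == l]eq_sym (negPf la) (negPf lb) /=.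
  move=> /eqP/root_factor[V EV]; exists V.
  by rewrite EW EV /P /cubic; ring.
apply: (split_of_factors (g := P) (U := p + (-1)%:P * 'X^n) (p := p) (q := q)
  n_gt0 _ (esym EV)) => //.
- by rewrite mul1r.
- by rewrite sqrrN expr1n.
- by rewrite mul1r.
- by rewrite mul1r.
- by rewrite size_poly1; have := odd_double_half n; rewrite on; lia.
- by rewrite size_cubic; have := odd_double_half n; rewrite on; lia.
Qed.

(** Here the cubic is nonnegative on [[0, l]] and on [[b, a]]: the sign at [l] is that at 0, and the
    signs at [a] and [b] agree. *)
Lemma ellipse_split : l < b -> c1 = c2 /\
  (c1 = -1 -> if odd n then split_at0 n 1 Y else split_at0 n (l%:P - 'X) Y).
Proof.
move=> lb; have [c3 c33 p3] := sign_l.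
have E3 := sign_at_first l_gt0 (ltW lb) (lexx l) c33 p3.
have E2 := sign_at_last b_gt0 (lexx b) (ltW lb) (ltW b_lt_a) c22 pb.
split=> // E1; rewrite -signr_odd in E3; case: ifPn E3 => on E3.
  apply: split_one => //; rewrite ?lt_eqF //; first exact: lt_trans b_lt_a.
  - by rewrite pa E1 mulN1r.
  - by rewrite pb E2 E1 mulN1r.
  - by rewrite p3 E3 mulN1r.
apply: (@split_lin l a b 1); rewrite ?gt_eqF ?expr1n //.
- by rewrite /P /cubic; ring.
- by rewrite p3 E3.
- by rewrite pa E1.
- by rewrite pb E2 E1.
Qed.

(** Here the cubic is nonnegative on [[0, b]] and on [[l, a]]: the sign at [b] is that at 0, and the
    sign at [l] is that at [a]. *)
Lemma hyperbola_split : b < l -> l < a -> c2 = (-1) ^+ n /\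
  (if odd n then c1 = -1 -> split_at0 n 1 Y
   else c1 = -1 -> split_at0 n (b%:P - 'X) Y) /\
  (odd n -> c1 = 1 -> split_at0 n (b%:P - 'X) Y).
Proof.
move=> bl la; have [c3 c33 p3] := sign_l.
have E2 := sign_at_first b_gt0 (lexx b) (ltW bl) c22 pb.
have E3 := sign_at_last l_gt0 (ltW bl) (lexx l) (ltW la) c33 p3.
split=> //; move: E2; rewrite -signr_odd; split.
  case: ifPn E2 => on E2 E1.
    apply: split_one; rewrite ?(gt_eqF bl) ?(lt_eqF la) //.
    - by rewrite pa E1 mulN1r.
    - by rewrite pb E2 mulN1r.
    - by rewrite p3 E3 E1 mulN1r.
  apply: (@split_lin b a l 1); rewrite ?gt_eqF ?expr1n //.
  - by rewrite /P /cubic; ring.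
  - by rewrite pb E2.
  - by rewrite pa E1.
  - by rewrite p3 E3 E1.
move=> on E1; rewrite on in E2.
apply: (@split_lin b a l (-1)); rewrite ?gt_eqF ?sqrrN ?expr1n //.
- by rewrite /P /cubic; ring.
- by rewrite pb E2.
- by rewrite pa E1 opprK.
- by rewrite p3 E3 E1 opprK.
Qed.

End Classification.

(** * Taylor polynomials of the square root *)

Section Taylor.
Variable R : realType.
Implicit Types (p : {poly R}) (f : R -> R) (c : nat -> R).

Lemma dvdXn_of_bigO p K (M d : R) : 0 < d ->
  (forall x, 0 < `|x| < d -> `|p.[x]| <= M * `|x| ^+ K) -> 'X^K %| p.
Proof.
move=> d0; elim: K p => [|K IH] p H; first by rewrite expr0 dvd1p.
have p0 : p.[0] = 0.
  apply/eqP; apply: contraT => p0.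
  have /factor_theorem[w Ew] : root (p - p.[0]%:P) 0.
    by rewrite rootE !hornerE subrr.
  rewrite subr0 in Ew.
  have [C HC] := poly_disk_bound w 1.
  have C0 : 0 <= C by apply: le_trans (HC 0 _); rewrite ?normr0.
  set m := `|M| + C; have m0 : 0 <= m by rewrite addr_ge0.
  have e0 : 0 < `|p.[0]| by rewrite normr_gt0.
  set e := `|p.[0]| in e0 *.
  (* At this [x], the assumed bound on [p(x)] and the bound [C x] on [p(x) - p(0)] add up to less
     than the absolute value of [p(0)]. *)
  set x := Num.min (d / 2) (Num.min 1 (e / (m + 1) / 2)).
  have x0 : 0 < x by rewrite !lt_min ltr01 !divr_gt0 //; lra.
  have xd : x <= d / 2 by rewrite ge_min lexx.
  have x1 : x <= 1 by rewrite !ge_min lexx orbT.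
  have xe : x <= e / (m + 1) / 2 by rewrite !ge_min lexx !orbT.
  have nx : `|x| = x by rewrite gtr0_norm.
  have h1 : `|p.[x]| <= `|M| * x.
    apply: le_trans (H x _) _; first by rewrite nx x0 /=; lra.
    apply: (@le_trans _ _ (`|M| * `|x| ^+ K.+1)).
      by rewrite ler_wpM2r ?exprn_ge0 // ler_norm.
    by rewrite nx ler_wpM2l // exprS ler_piMr ?exprn_ile1 // ltW.
  have h2 : `|p.[x] - p.[0]| <= C * x.
    have -> : p.[x] - p.[0] = w.[x] * x.
      by have := congr1 (horner^~ x) Ew; rewrite !hornerE.
    by rewrite normrM nx; apply: ler_wpM2r; [exact: ltW | rewrite HC ?nx].
  have h3 : e <= m * x.
    rewrite /e -[p.[0]](subKr p.[x]); apply: le_trans (ler_normB _ _) _.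
    by rewrite /m mulrDl lerD.
  have : m * x < e.
    apply: (@le_lt_trans _ _ (e / 2)); last by lra.
    apply: le_trans (ler_wpM2l m0 xe) _.
    rewrite mulrA ler_pM2r ?invr_gt0 // mulrCA ger_pMr // ler_pdivrMr; lra.
  by rewrite ltNge h3.
have /factor_theorem[w Ew] : root p 0 by apply/eqP.
rewrite subr0 in Ew; rewrite Ew exprSr dvdp_mul2r ?polyX_eq0 //.
apply: IH => x xd; have x0 : 0 < `|x| by case/andP: xd.
have := H x xd; rewrite Ew hornerM hornerX normrM exprSr mulrA.
by rewrite ler_pM2r.
Qed.

(** Convergence at a point [y > 0] bounds the terms [c_i y^i]. For [x] of absolute value below
    [y / 2], the tail is then dominated by a geometric series of ratio at most 1/2. *)
Lemma taylor_trunc f c K : taylor_expansion_at0 f c ->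
  exists M d, 0 < d /\ forall x, `|x| < d ->
    `|f x - (\poly_(i < K) c i).[x]| <= M * `|x| ^+ K.
Proof.
move=> /nbhs_ballP[d0 /= d0_gt0 H].
have {}H x : `|x| < d0 -> pseries c x @ \oo --> f x.
  by move=> xd; apply: H; rewrite /ball /= sub0r normrN.
set y := d0 / 2.
have y0 : 0 < y by rewrite divr_gt0.
have : `|y| < d0 by rewrite gtr0_norm // /y; lra.
move=> /H cy; have /cvg_series_bounded : cvgn (pseries c y) by apply: cvgP cy.
move=> [M0 [_ /(_ (M0 + 1))]]; have HM0 : M0 < M0 + 1 by rewrite ltrDl.
move=> /(_ HM0); move: (M0 + 1) => M HM {HM0}.
have {}HM i : `|c i| * y ^+ i <= M.
  by have := HM i I; rewrite /= normrM normrX (gtr0_norm y0).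
exists (M * 2 / y ^+ K), (y / 2); split; first by rewrite divr_gt0.
move=> x xy; have xd : `|x| < d0.
  by apply: lt_trans xy _; rewrite /y; lra.
set r := `|x| / y.
have r0 : 0 <= r by rewrite divr_ge0 // ltW.
have r2 : r <= 2^-1.
  by rewrite ler_pdivrMr // mulrC ltW.
have bound N : `|\sum_(K <= i < K + N) c i * x ^+ i| <= M * 2 * r ^+ K.
  have {}HM i : `|c i * x ^+ i| <= M * r ^+ i.
    rewrite normrM normrX expr_div_n mulrA ler_pdivlMr ?exprn_gt0 //.
    by rewrite mulrAC ler_wpM2r ?exprn_ge0.
  have Mge0 : 0 <= M.
    by have := le_trans (normr_ge0 _) (HM 0%N); rewrite expr0 mulr1.
  apply: le_trans (ler_norm_sum _ _ _) _.
  (* The correction [- 2 r^N] makes the induction work, as [r^N <= 2 r^N - 2 r^(N+1)] for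
     [0 <= r <= 1/2]. *)
  suff : \sum_(K <= i < K + N) `|c i * x ^+ i| <= M * r ^+ K * (2 - 2 * r ^+ N).
    move/le_trans; apply; have := exprn_ge0 N r0; have := exprn_ge0 K r0.
    by move=> hK hN; rewrite [leRHS]mulrAC; apply: ler_wpM2l; [exact: mulr_ge0 | lra].
  elim: N => [|N IHN]; first by rewrite addn0 big_geq // expr0 mulr1 subrr mulr0.
  rewrite addnS big_nat_recr ?leq_addr //=.
  apply: le_trans (lerD IHN (HM _)) _.
  rewrite exprD mulrA -mulrDr; apply: ler_wpM2l.
    by rewrite mulr_ge0 ?exprn_ge0.
  rewrite exprS.
  have := exprn_ge0 N r0; move: (r ^+ N) => z z0; nra.
have -> : M * 2 / y ^+ K * `|x| ^+ K = M * 2 * r ^+ K.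
  by rewrite [in RHS]expr_div_n [RHS]mulrA mulrAC.
have cv : (fun n => `|pseries c x n - (\poly_(i < K) c i).[x]|) @ \oo -->
    `|f x - (\poly_(i < K) c i).[x]|.
  by apply: cvg_norm; apply: cvgB; [exact: H | exact: cvg_cst].
apply: (ler_cvg_to cv (cvg_cst _)); exists K => // n /= le_Kn.
rewrite /pseries /series /= (big_cat_nat (n := K)) //= horner_poly big_mkord.
by rewrite addrAC subrr add0r -(subnKC le_Kn).
Qed.

Lemma taylor_trunc_eq (p q : {poly R}) f1 f2 c1 c2 K :
  taylor_expansion_at0 f1 c1 -> taylor_expansion_at0 f2 c2 ->
  (\forall x \near (0 : R), p.[x] * f1 x = q.[x] * f2 x) ->
  'X^K %| p * \poly_(i < K) c1 i - q * \poly_(i < K) c2 i.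
Proof.
move=> /(taylor_trunc K)[M1 [d1 [d1_gt0 H1]]].
move=> /(taylor_trunc K)[M2 [d2 [d2_gt0 H2]]] /nbhs_ballP[d3 /= d3_gt0 H3].
have [C1 HC1] := poly_disk_bound p 1; have [C2 HC2] := poly_disk_bound q 1.
set d := Num.min (Num.min d1 d2) (Num.min d3 1).
apply: (@dvdXn_of_bigO _ _ (C1 * M1 + C2 * M2) d).
  by rewrite !lt_min d1_gt0 d2_gt0 d3_gt0 ltr01.
move=> x /andP[_]; rewrite !lt_min => /andP[/andP[xd1 xd2] /andP[xd3 x1]].
have Hx : p.[x] * f1 x = q.[x] * f2 x.
  by apply: H3; rewrite /ball /= sub0r normrN.
have -> : (p * \poly_(i < K) c1 i - q * \poly_(i < K) c2 i).[x] =
    q.[x] * (f2 x - (\poly_(i < K) c2 i).[x])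
    - p.[x] * (f1 x - (\poly_(i < K) c1 i).[x]).
  rewrite hornerD hornerN !hornerM.
  by apply: (eq_of_lincomb (k := 1) Hx); ring.
apply: le_trans (ler_normB _ _) _; rewrite !normrM addrC mulrDl -!mulrA.
by apply: lerD; apply: ler_pM => //; [apply: HC1|apply: H1|apply: HC2|apply: H2];
  rewrite ?ltW.
Qed.

End Taylor.

(** * Expansions of the square root of the cubic and of its quotients *)

Section SqrtCubic.
Variables (R : realType) (a b l : R).
Hypotheses (a_gt0 : 0 < a) (b_gt0 : 0 < b) (l_gt0 : 0 < l).

Lemma near_lt (c : R) : 0 < c -> \forall x \near (0 : R), x < c.
Proof. by move=> c0; exact: lt_nbhsl. Qed.

Lemma sqrt_cubic_taylor B K :
  taylor_expansion_at0 (fun x => sqrt_cubic a b l x) B ->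
  'X^K %| cubic a b l - (\poly_(i < K) B i) ^+ 2.
Proof.
move=> HB; have [M1 [d1 [d1_gt0 H1]]] := taylor_trunc K HB.
set Y := \poly_(i < K) B i.
have [C HC] := poly_disk_bound Y 1.
set d2 := Num.min (Num.min a b) l.
apply: (@dvdXn_of_bigO _ _ _ (M1 * (C + C + `|M1|)) (Num.min (Num.min d1 d2) 1)).
  by rewrite !lt_min d1_gt0 a_gt0 b_gt0 l_gt0 ltr01.
move=> x /andP[_]; rewrite !lt_min => /andP[/andP[xd1 /andP[/andP[xa xb] xl]] x1].
have lex c : `|x| < c -> 0 <= c - x.
  by move=> xc; rewrite subr_ge0; apply: le_trans (ler_norm x) (ltW xc).
set S := sqrt_cubic a b l x.
have S2 : S ^+ 2 = (a - x) * (b - x) * (l - x).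
  by rewrite /S /sqrt_cubic sqr_sqrtr // !mulr_ge0 // lex.
have SY : `|S - Y.[x]| <= M1 * `|x| ^+ K by exact: H1.
have -> : (cubic a b l - Y ^+ 2).[x] = (S - Y.[x]) * (S + Y.[x]).
  rewrite hornerD hornerN horner_exp /cubic !hornerS.
  by apply: (eq_of_lincomb (k := -1) S2); ring.
rewrite normrM mulrAC; apply: ler_pM => //.
have YC : `|Y.[x]| <= C by apply: HC; exact: ltW.
have -> : S + Y.[x] = Y.[x] + Y.[x] + (S - Y.[x]) by ring.
apply: le_trans (ler_normD _ _) _; apply: lerD.
  by apply: le_trans (ler_normD _ _) _; apply: lerD.
apply: le_trans SY _; apply: (@le_trans _ _ (`|M1| * `|x| ^+ K)).
  by rewrite ler_wpM2r ?exprn_ge0 // ler_norm.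
by rewrite ler_piMr // exprn_ile1 // ltW.
Qed.

Lemma sqrt_cubic_taylor0 B K :
  taylor_expansion_at0 (fun x => sqrt_cubic a b l x) B ->
  (\poly_(i < K.+1) B i).[0] = Num.sqrt (a * b * l).
Proof.
move=> /(taylor_trunc 1)[M [d [d0 /(_ 0)]]].
rewrite normr0 => /(_ d0); rewrite expr1 mulr0 normr_le0 subr_eq0 => /eqP.
rewrite /sqrt_cubic !subr0 => ->.
by rewrite !horner_coef0 !coef_poly.
Qed.

Lemma sqrt_cubic_div_taylor (c : R) (B C : nat -> R) K : 0 < c ->
  taylor_expansion_at0 (fun x => sqrt_cubic a b l x) B ->
  taylor_expansion_at0 (fun x => sqrt_cubic a b l x / (c - x)) C ->
  'X^K %| (c%:P - 'X) * \poly_(i < K) C i - \poly_(i < K) B i.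
Proof.
move=> c0 HB HC; rewrite -[\poly_(i < K) B i]mul1r.
apply: taylor_trunc_eq HC HB _; near=> x.
have : x < c by near: x; exact: near_lt.
by rewrite -subr_gt0 => cx; rewrite !hornerS; field; rewrite gt_eqF.
Unshelve. all: by end_near. Qed.

End SqrtCubic.

(** * Elliptic coordinates and caustics *)

Section PlaneLemmas.
Variable R : realType.
Implicit Types P Q : 'rV[R]_2.

Lemma rV2P P Q : xc P = xc Q -> yc P = yc Q -> P = Q.
Proof.
move=> hx hy; apply/rowP => i; case: i => -[|[|//]] i2.
  by move: hx; rewrite /xc; congr (_ = _); congr (_ _ _); apply: val_inj.
by move: hy; rewrite /yc; congr (_ = _); congr (_ _ _); apply: val_inj.
Qed.

Lemma xcD P Q : xc (P + Q) = xc P + xc Q. Proof. by rewrite /xc mxE. Qed.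
Lemma xcN P : xc (- P) = - xc P. Proof. by rewrite /xc mxE. Qed.
Lemma xcZ z P : xc (z *: P) = z * xc P. Proof. by rewrite /xc mxE. Qed.
Lemma ycD P Q : yc (P + Q) = yc P + yc Q. Proof. by rewrite /yc mxE. Qed.
Lemma ycN P : yc (- P) = - yc P. Proof. by rewrite /yc mxE. Qed.
Lemma ycZ z P : yc (z *: P) = z * yc P. Proof. by rewrite /yc mxE. Qed.

Definition coordE := (xcD, xcN, xcZ, ycD, ycN, ycZ).

Lemma dot_gt0 P : P <> 0 -> 0 < dot P P.
Proof.
move=> P0; rewrite lt_neqAle eq_sym /dot -!expr2 addr_ge0 ?sqr_ge0 // andbT.
apply/eqP => /eqP; rewrite paddr_eq0 ?sqr_ge0 // !sqrf_eq0 => /andP[/eqP h1 /eqP h2].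
by apply: P0; apply: rV2P; rewrite ?h1 ?h2 /xc /yc mxE.
Qed.

Lemma enorm_gt0 P Q : P <> Q -> 0 < enorm (Q - P).
Proof.
move=> PQ; rewrite sqrtr_gt0; apply: dot_gt0 => /eqP.
by rewrite subr_eq0 eq_sym => /eqP.
Qed.

Lemma enorm_direction P Q : P <> Q -> Q = P + enorm (Q - P) *: direction P Q.
Proof.
move=> PQ; rewrite /direction scalerA mulfV ?gt_eqF ?enorm_gt0 // scale1r.
by rewrite addrC subrK.
Qed.

Lemma direction_unit P Q : P <> Q ->
  xc (direction P Q) ^+ 2 + yc (direction P Q) ^+ 2 = 1.
Proof.
move=> PQ; have e0 := enorm_gt0 PQ; rewrite /direction.
move: (Q - P) e0 => D e0.
have E : enorm D ^+ 2 = xc D ^+ 2 + yc D ^+ 2.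
  by rewrite sqr_sqrtr /dot -?expr2 ?addr_ge0 ?sqr_ge0 // !expr2.
rewrite !coordE !exprMn -mulrDr -E exprVn mulVf //.
by rewrite expf_neq0 // gt_eqF.
Qed.

Lemma sign_pair (x d X D : R) :
  X ^+ 2 = x ^+ 2 -> D ^+ 2 = d ^+ 2 -> X * D = x * d ->
  exists2 c, c ^+ 2 = 1 & X = c * x /\ D = c * d.
Proof.
move=> hX hD hXD; have [x0|x0] := eqVneq x 0.
  have X0 : X = 0 by move/eqP: hX; rewrite x0 expr0n sqrf_eq0 => /eqP.
  have [d0|d0] := eqVneq d 0.
    have D0 : D = 0 by move/eqP: hD; rewrite d0 expr0n sqrf_eq0 => /eqP.
    by exists 1; rewrite ?expr1n // X0 D0 x0 d0 mulr0.
  exists (D / d); last by rewrite X0 x0 mulr0 divfK.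
  by rewrite expr_div_n hD mulfV // expf_neq0.
exists (X / x); first by rewrite expr_div_n hX mulfV // expf_neq0.
have X0 : X != 0 by rewrite -sqrf_eq0 hX sqrf_eq0.
split; first by rewrite divfK.
apply: (mulfI X0); rewrite hXD.
have -> : X * (X / x * d) = X ^+ 2 * d / x by ring.
by rewrite hX; field.
Qed.

End PlaneLemmas.

(** * Elliptic coordinates up to reflections in the axes, and tangency to the caustic *)

Section EllipticCoordinates.
Variables (R : realType) (a b : R).
Hypothesis b_lt_a : b < a.
Implicit Types P Q : 'rV[R]_2.

(* Clearing denominators accounts for the two degenerate conics as well. *)
Lemma on_confocalE l P : on_confocal a b l P <->
  (a - l) * (b - l) - xc P ^+ 2 * (b - l) - yc P ^+ 2 * (a - l) = 0.
Proof.
rewrite /on_confocal; case: eqP => [->|/eqP la].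
  rewrite subrr mul0r mulr0 subr0 sub0r; split=> [->|/eqP].
    by rewrite expr0n mul0r oppr0.
  rewrite oppr_eq0 mulf_eq0 sqrf_eq0 => /orP[/eqP //|].
  by rewrite subr_eq0 lt_eqF.
case: eqP => [->|/eqP lb].
  rewrite subrr !mulr0 sub0r oppr0 add0r; split=> [->|/eqP].
    by rewrite expr0n mul0r oppr0.
  rewrite oppr_eq0 mulf_eq0 sqrf_eq0 => /orP[/eqP //|].
  by rewrite subr_eq0 gt_eqF.
have la' : a - l != 0 by rewrite subr_eq0 eq_sym.
have lb' : b - l != 0 by rewrite subr_eq0 eq_sym.
have E : (a - l) * (b - l) - xc P ^+ 2 * (b - l) - yc P ^+ 2 * (a - l) =
  (a - l) * (b - l) * (1 - (xc P ^+ 2 / (a - l) + yc P ^+ 2 / (b - l))).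
  by field; rewrite la' lb'.
rewrite E; split=> [->|/eqP]; first by rewrite subrr mulr0.
by rewrite mulf_eq0 mulf_eq0 (negPf la') (negPf lb') subr_eq0 => /eqP.
Qed.

(** Elliptic coordinates are the roots of [z^2 - S z + T], whose discriminant is a sum of
    nonnegative terms vanishing only at the foci. Two distinct roots determine the squares of [xc]
    and [yc] through a linear system. Applied in both directions, this leaves only the case of two
    foci, whose squares agree. *)
Lemma same_elliptic_coordinatesP P Q : same_elliptic_coordinates a b P Q <->
  xc P ^+ 2 = xc Q ^+ 2 /\ yc P ^+ 2 = yc Q ^+ 2.
Proof.
split=> [PQ|[hx hy] l1 l2]; last first.
  by rewrite /elliptic_coordinates; split=> -[H1 H2 H3]; split=> //;
    move: H2 H3; rewrite !on_confocalE hx hy.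
have get P' Q' : same_elliptic_coordinates a b P' Q' ->
    (xc P' ^+ 2 = xc Q' ^+ 2 /\ yc P' ^+ 2 = yc Q' ^+ 2) \/
    (xc P' ^+ 2 = a - b /\ yc P' ^+ 2 = 0).
  move=> PQ'.
  set S := a + b - xc P' ^+ 2 - yc P' ^+ 2.
  set T := a * b - b * xc P' ^+ 2 - a * yc P' ^+ 2.
  have hx := sqr_ge0 (xc P'); have hy := sqr_ge0 (yc P').
  have dy : 0 <= 4 * (yc P' ^+ 2 * (a - b)).
    by rewrite pmulr_rge0 // mulr_ge0 // subr_ge0 ltW.
  have dE : S ^+ 2 - 4 * T = (S - 2 * b) ^+ 2 + 4 * (yc P' ^+ 2 * (a - b)).
    by rewrite /S /T; ring.
  have [d0|d0] := eqVneq (S ^+ 2 - 4 * T) 0.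
    right; move/eqP: d0; rewrite dE paddr_eq0 ?sqr_ge0 //.
    rewrite sqrf_eq0 mulf_eq0 pnatr_eq0 /= mulf_eq0 [a - b == 0]subr_eq0.
    rewrite (gt_eqF b_lt_a) orbF => /andP[/eqP h1 /eqP h2].
    by split=> //; move: h1; rewrite /S h2; lra.
  left; have dge : 0 <= S ^+ 2 - 4 * T.
    by rewrite dE addr_ge0 ?sqr_ge0.
  set r := Num.sqrt (S ^+ 2 - 4 * T).
  have r2 : r ^+ 2 = S ^+ 2 - 4 * T by rewrite sqr_sqrtr.
  have r0 : 0 < r by rewrite sqrtr_gt0 lt_neqAle eq_sym d0.
  have root e : e ^+ 2 = 1 -> on_confocal a b ((S + e * r) / 2) P'.
    move=> e2; rewrite on_confocalE.
    have E : T = (S ^+ 2 - r ^+ 2) / 4 by rewrite r2; field.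
    have -> : (a - (S + e * r) / 2) * (b - (S + e * r) / 2)
      - xc P' ^+ 2 * (b - (S + e * r) / 2) - yc P' ^+ 2 * (a - (S + e * r) / 2)
      = T - S * ((S + e * r) / 2) + ((S + e * r) / 2) ^+ 2.
      by rewrite /T /S; field.
    rewrite E; clear -e2; have -> : r ^+ 2 = e ^+ 2 * r ^+ 2 by rewrite e2 mul1r.
    by field.
  have lt12 : (S + - 1 * r) / 2 < (S + 1 * r) / 2.
    by rewrite ltr_pM2r ?invr_gt0 //; lra.
  have /PQ'[_ q1 q2] :
      elliptic_coordinates a b P' ((S + - 1 * r) / 2) ((S + 1 * r) / 2).
    by split=> //; apply: root; rewrite ?sqrrN expr1n.
  have p1 : on_confocal a b ((S + - 1 * r) / 2) P'.
    by apply: root; rewrite sqrrN expr1n.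
  have p2 : on_confocal a b ((S + 1 * r) / 2) P' by apply: root; rewrite expr1n.
  move: lt12 p1 p2 q1 q2; rewrite !on_confocalE.
  move: ((S + - 1 * r) / 2) ((S + 1 * r) / 2) => l1 l2 l12.
  set x := xc P' ^+ 2; set y := yc P' ^+ 2; set x' := xc Q' ^+ 2; set y' := yc Q' ^+ 2.
  move=> p1 p2 q1 q2.
  have l0 : l2 - l1 != 0 by rewrite subr_eq0 gt_eqF.
  have ab0 : a - b != 0 by rewrite subr_eq0 gt_eqF.
  have s1 : x + y = x' + y'.
    apply: (mulfI l0).
    apply: (eq_of_lincomb (k := 1) p2); apply: (eq_of_lincomb (k := -1) p1).
    by apply: (eq_of_lincomb (k := -1) q2); apply: (eq_of_lincomb (k := 1) q1); ring.
  have s2 : b * x + a * y = b * x' + a * y'.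
    apply: (eq_of_lincomb (k := -1) p1); apply: (eq_of_lincomb (k := 1) q1).
    by apply: (eq_of_lincomb (k := l1) s1); ring.
  have sy : y = y'.
    apply: (mulfI ab0); apply: (eq_of_lincomb (k := 1) s2).
    by apply: (eq_of_lincomb (k := -b) s1); ring.
  by split=> //; move: s1; rewrite sy => /addIr.
have [//|[x1 y1]] := get _ _ PQ.
have [[-> ->] //|[x2 y2]] := get Q P (fun l1 l2 => iff_sym (PQ l1 l2)).
by rewrite x1 y1 x2 y2.
Qed.

(** The vector [(X / (a - l), Y / (b - l))] is normal to the line, hence [k] times the velocity
    turned by a right angle. The equation of the conic is then the claim multiplied by [k^2], and
    [k = 0] would make [X], [Y], [Z] all vanish. *)
Lemma tangent_line_caustic l P Q : l != a -> l != b -> P <> Q ->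
  tangent_line a b l P Q -> let u := direction P Q in
  xc u ^+ 2 * (b - l) + yc u ^+ 2 * (a - l) =
  (xc P * yc u - yc P * xc u) ^+ 2.
Proof.
move=> la lb PQ [X [Y [Z [nz conic tP tQ]]]] u.
have al : a - l != 0 by rewrite subr_eq0 eq_sym.
have bl : b - l != 0 by rewrite subr_eq0 eq_sym.
have := enorm_direction PQ; have := direction_unit PQ; rewrite -/u.
have := enorm_gt0 PQ; move: (enorm _) => t t0 u1 QE.
clearbody u.
move: tQ; rewrite QE !coordE; move: tP conic u1.
move: (xc P) (yc P) (xc u) (yc u) => x y v w tP conic u1 tQ.
have [X' EX] : exists X', X = X' * (a - l) by exists (X / (a - l)); rewrite divfK.
have [Y' EY] : exists Y', Y = Y' * (b - l) by exists (Y / (b - l)); rewrite divfK.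
move: tP tQ conic; rewrite EX EY !mulrA !mulfK //.
rewrite !exprMn !expr2 !mulrA !mulfK // => tP tQ conic.
have dir : v * X' + w * Y' = 0.
  have : t * (v * X' + w * Y') = 0.
    by apply: (eq_of_lincomb (k := 1) tQ); apply: (eq_of_lincomb (k := -1) tP); ring.
  by move/eqP; rewrite mulf_eq0 gt_eqF // => /eqP.
set k := w * X' - v * Y'.
have kX : X' = k * w.
  apply: (eq_of_lincomb (k := - X') u1).
  by apply: (eq_of_lincomb (k := v) dir); rewrite /k; ring.
have kY : Y' = - (k * v).
  apply: (eq_of_lincomb (k := - Y') u1).
  by apply: (eq_of_lincomb (k := w) dir); rewrite /k; ring.
have k0 : k != 0.
  apply/eqP => k0; apply: nz; rewrite EX EY -tP kX kY k0; congr (_, _, _); ring.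
apply: (mulfI (expf_neq0 2 k0)).
move: conic; rewrite -tP kX kY => conic.
by apply: (eq_of_lincomb (k := 1) conic); ring.
Qed.

End EllipticCoordinates.

(** * Billiard trajectories *)

Section Trajectory.
Variables (R : realType) (a b l : R) (V : nat -> 'rV[R]_2).
Hypotheses (b_gt0 : 0 < b) (b_lt_a : b < a) (la : l != a) (lb : l != b).
Hypotheses (l_gt0 : 0 < l) (HV : billiard_trajectory a b V)
  (HC : has_caustic a b V l).

Let onV := let: And3 h _ _ := HV in h.
Let neqV := let: And3 _ h _ := HV in h.
Let reflV := let: And3 _ _ h := HV in h.

Definition vel k := direction (V k) (V k.+1).
Definition bounce k : R :=
  - (2 * dot (vel k) (normal a b (V k.+1)) /
     dot (normal a b (V k.+1)) (normal a b (V k.+1))).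

Let x1 k := xc (V k).
Let x2 k := yc (V k).
Let u1 k := xc (vel k).
Let u2 k := yc (vel k).
Let t k := enorm (V k.+1 - V k).

Let s := Num.sqrt (a * b * l).
Let a_gt0 : 0 < a. Proof. exact: lt_trans b_lt_a. Qed.
Let s_gt0 : 0 < s. Proof. by rewrite sqrtr_gt0 !mulr_gt0. Qed.
Let s2 : s ^+ 2 = a * b * l. Proof. by rewrite sqr_sqrtr // !mulr_ge0 // ltW. Qed.

Let unitE k : u1 k ^+ 2 + u2 k ^+ 2 = 1.
Proof. exact: direction_unit. Qed.

Let causticE k : u1 k ^+ 2 * (b - l) + u2 k ^+ 2 * (a - l) =
  (x1 k * u2 k - x2 k * u1 k) ^+ 2.
Proof. exact: tangent_line_caustic. Qed.

Let t_gt0 k : 0 < t k.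
Proof. exact: enorm_gt0. Qed.

Let VS k : V k.+1 = V k + t k *: vel k.
Proof. exact: enorm_direction. Qed.

Let x1S k : x1 k.+1 = x1 k + t k * u1 k.
Proof. by rewrite /x1 VS xcD xcZ. Qed.

Let x2S k : x2 k.+1 = x2 k + t k * u2 k.
Proof. by rewrite /x2 VS ycD ycZ. Qed.

Let velS k : vel k.+1 = vel k + bounce k *: normal a b (V k.+1).
Proof. by rewrite /vel (reflV k) scaleNr. Qed.

Let u1S k : u1 k.+1 = u1 k + bounce k * (x1 k.+1 / a).
Proof. by rewrite /u1 velS xcD xcZ {2}/xc mxE. Qed.

Let u2S k : u2 k.+1 = u2 k + bounce k * (x2 k.+1 / b).
Proof. by rewrite /u2 velS ycD ycZ {2}/yc mxE. Qed.

Definition sign_periodic n (c1 c2 : R) :=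
  [/\ xc (V n) = c1 * xc (V 0), xc (vel n) = c1 * xc (vel 0),
      yc (V n) = c2 * yc (V 0) & yc (vel n) = c2 * yc (vel 0)].

(** On the segments of index 0 and [n] the coordinates are affine functions with equal squares, so
    each pair agrees up to one sign, common to position and displacement. *)
Lemma elliptic_periodicP n : elliptic_periodic a b n V <->
  exists c1 c2, [/\ c1 ^+ 2 = 1, c2 ^+ 2 = 1 & sign_periodic n c1 c2].
Proof.
split=> [ell|[c1 [c2 [c11 c22 [h1 h2 h3 h4]]]] k r _]; last first.
  have H j := sign_propagate b_gt0 b_lt_a s_gt0 s2 onV unitE causticE t_gt0
    x1S x2S u1S u2S c11 c22 h1 h2 h3 h4 j.
  have [k1 _ k3 _] := H k; have [j1 _ j3 _] := H k.+1.
  apply/(same_elliptic_coordinatesP b_lt_a); rewrite /moving_point !coordE.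
  rewrite -addSn.
  have sq c z z' : c ^+ 2 = 1 ->
      (c * z + r * (c * z' - c * z)) ^+ 2 = (z + r * (z' - z)) ^+ 2.
    by move=> cc; rewrite -[RHS]mul1r -cc; ring.
  by rewrite k1 k3 j1 j3 !sq.
have sq r : 0 <= r <= 1 ->
    (x1 n + r * (t n * u1 n)) ^+ 2 = (x1 0 + r * (t 0 * u1 0)) ^+ 2 /\
    (x2 n + r * (t n * u2 n)) ^+ 2 = (x2 0 + r * (t 0 * u2 0)) ^+ 2.
  have xr m : xc (moving_point V m r) = x1 m + r * (t m * u1 m).
    rewrite /moving_point VS xcD xcZ xcD xcN xcD xcZ -![xc (V _)]/(x1 _).
    by rewrite -[xc _]/(u1 m); ring.
  have yr m : yc (moving_point V m r) = x2 m + r * (t m * u2 m).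
    rewrite /moving_point VS ycD ycZ ycD ycN ycD ycZ -![yc (V _)]/(x2 _).
    by rewrite -[yc _]/(u2 m); ring.
  move=> /(ell 0%N)/(same_elliptic_coordinatesP b_lt_a).
  by rewrite add0n !xr !yr.
have quad (x d X D : R) :
    (forall r, 0 <= r <= 1 -> (X + r * D) ^+ 2 = (x + r * d) ^+ 2) ->
    exists2 c, c ^+ 2 = 1 & X = c * x /\ D = c * d.
  (* The values at 0, 1/2 and 1 determine the three coefficients of a quadratic polynomial in
     [r]. *)
  move=> H; have := H 0; have := H 1; have := H 2^-1.
  rewrite !lexx ler01 invr_ge0 ler0n invf_le1 ?ltr0n // ler1n => /(_ isT) h2.
  move=> /(_ isT) h1 /(_ isT) h0; apply: sign_pair.
  - by apply: (eq_of_lincomb (k := 1) h0); ring.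
  - apply: (eq_of_lincomb (k := 2) h1); apply: (eq_of_lincomb (k := - 4) h2).
    by apply: (eq_of_lincomb (k := 2) h0); field.
  - apply: (eq_of_lincomb (k := - 2^-1) h1); apply: (eq_of_lincomb (k := 2) h2).
    by apply: (eq_of_lincomb (k := - (3 / 2)) h0); field.
have [c1 c11 [e1 d1]] := quad _ _ _ _ (fun r h => (sq r h).1).
have [c2 c22 [e2 d2]] := quad _ _ _ _ (fun r h => (sq r h).2).
(* Displacements with equal squared components have the same length; dividing by it passes from
   displacements to velocities. *)
have tn : t n = t 0.
  apply/eqP; rewrite -(@eqrXn2 _ 2) ?ltW //; apply/eqP.
  apply: (eq_of_lincomb (k := - t n ^+ 2) (unitE n)).
  apply: (eq_of_lincomb (k := t 0 ^+ 2) (unitE 0)).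
  apply: (eq_of_lincomb (k := (t 0 * u1 0) ^+ 2) c11).
  apply: (eq_of_lincomb (k := (t 0 * u2 0) ^+ 2) c22).
  apply: (eq_of_lincomb (k := t n * u1 n + c1 * (t 0 * u1 0)) d1).
  by apply: (eq_of_lincomb (k := t n * u2 n + c2 * (t 0 * u2 0)) d2); ring.
have t0 : t 0 != 0 by rewrite gt_eqF.
exists c1, c2; split=> //; split=> //; apply: (mulfI t0).
  by rewrite -{1}tn; apply: etrans d1 _; exact: mulrCA.
by rewrite -{1}tn; apply: etrans d2 _; exact: mulrCA.
Qed.

Lemma periodicP n c1 c2 : c1 ^+ 2 = 1 -> c2 ^+ 2 = 1 ->
  sign_periodic n c1 c2 -> (periodic n V <-> c1 = 1 /\ c2 = 1).
Proof.
move=> c11 c22 [h1 h2 h3 h4]; split=> [per|[E1 E2] k].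
  have Vn : V n = V 0 := per 0%N; have Vn1 : V n.+1 = V 1 := per 1%N.
  have veln : vel n = vel 0 by rewrite /vel Vn Vn1.
  have fix1 (c z w : R) : (z, w) <> (0, 0) -> z = c * z -> w = c * w -> c = 1.
    move=> zw /eqP; rewrite -subr_eq0 -{1}[z]mul1r -mulrBl mulf_eq0.
    case/orP=> [|/eqP z0 /eqP]; first by rewrite subr_eq0 => /eqP.
    rewrite -subr_eq0 -{1}[w]mul1r -mulrBl mulf_eq0 subr_eq0.
    by case/orP=> [/eqP //|/eqP w0]; case: zw; rewrite z0 w0.
  move: h1 h2 h3 h4; rewrite Vn veln => h1 h2 h3 h4; split.
    exact: (fix1 _ _ _ (coord1_neq0 unitE causticE (k := 0%N) la)).
  exact: (fix1 _ _ _ (coord2_neq0 unitE causticE (k := 0%N) lb)).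
have [k1 _ k3 _] := sign_propagate b_gt0 b_lt_a s_gt0 s2 onV unitE causticE t_gt0
    x1S x2S u1S u2S c11 c22 h1 h2 h3 h4 k.
by apply: rV2P; [rewrite [LHS]k1 E1 mul1r | rewrite [LHS]k3 E2 mul1r].
Qed.

(** * Hankel conditions and the signs acquired after [n] bounces *)

Variables (B C D : nat -> R) (n : nat).
Hypotheses (n_gt1 : (1 < n)%N)
  (HB : taylor_expansion_at0 (fun x => sqrt_cubic a b l x) B)
  (HC' : taylor_expansion_at0 (fun x => sqrt_cubic a b l x / (l - x)) C)
  (HD : taylor_expansion_at0 (fun x => sqrt_cubic a b l x / (b - x)) D).

Let K := n.*2.+1.
Let Y : {poly R} := \poly_(i < K) B i.
Let P := cubic a b l.

Let Y0 : Y.[0] = s.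
Proof. exact: sqrt_cubic_taylor0. Qed.

Let dY : 'X^K %| P - Y ^+ 2.
Proof. exact: sqrt_cubic_taylor. Qed.

Let n_le_K : (n <= K)%N.
Proof. by rewrite /K -addnn leqW // leq_addr. Qed.

Let det_evenE (E : nat -> R) (f : {poly R}) : f.[0] != 0 ->
  'X^K %| f * \poly_(i < K) E i - Y ->
  (exists m, n = (2 * m)%N /\
     \det (\matrix_(i < m, j < m) E (i.+1 + j.+1 - 1)%N) = 0) <->
  ~~ odd n /\ split_at0 n f Y.
Proof.
move=> f0 dE; have step m : n = (2 * m)%N ->
    \det (\matrix_(i < m, j < m) E (i.+1 + j.+1 - 1)%N) = 0 <-> split_at0 n f Y.
  move=> nm; have hm : n./2 = m by rewrite nm mul2n doubleK.
  rewrite -(split_at0_det hm n_le_K f0 dE).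
  suff -> : \matrix_(i < m, j < m) E (i.+1 + j.+1 - 1)%N =
    \matrix_(i < m, j < m) E (i + j + (odd n).+1)%N by [].
  apply/matrixP => i j; rewrite !mxE nm oddM /=; congr E.
  by rewrite addSn addnS subn1 addn1.
split=> [[m [nm /(step m nm) H]]|[on H]]; first by rewrite nm oddM -nm.
exists n./2; have nm : n = (2 * n./2)%N.
  by rewrite mul2n -[LHS]odd_double_half (negPf on).
by split=> //; apply/(step _ nm).
Qed.

Let det_oddE (E : nat -> R) (f : {poly R}) : f.[0] != 0 ->
  'X^K %| f * \poly_(i < K) E i - Y ->
  (exists m, n = (2 * m + 1)%N /\
     \det (\matrix_(i < m, j < m) E (i.+1 + j.+1)%N) = 0) <->
  odd n /\ split_at0 n f Y.
Proof.
move=> f0 dE; have step m : n = (2 * m + 1)%N ->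
    \det (\matrix_(i < m, j < m) E (i.+1 + j.+1)%N) = 0 <-> split_at0 n f Y.
  move=> nm; have hm : n./2 = m by rewrite nm addn1 mul2n /= uphalf_double.
  rewrite -(split_at0_det hm n_le_K f0 dE).
  suff -> : \matrix_(i < m, j < m) E (i.+1 + j.+1)%N =
    \matrix_(i < m, j < m) E (i + j + (odd n).+1)%N by [].
  apply/matrixP => i j; rewrite !mxE nm oddD oddM /=; congr E.
  by rewrite addSn addnS addn2.
split=> [[m [nm /(step m nm) H]]|[on H]].
  by split=> //; rewrite nm oddD oddM.
exists n./2; have nm : n = (2 * n./2 + 1)%N.
  by rewrite mul2n addnC -[LHS]odd_double_half on.
by split=> //; apply/(step _ nm).
Qed.

Let lin0 (z : R) : 0 < z -> (z%:P - 'X : {poly R}).[0] != 0.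
Proof. by move=> z0; rewrite !hornerS subr0 gt_eqF. Qed.

Let dB : 'X^K %| 1 * \poly_(i < K) B i - Y.
Proof. by rewrite mul1r subrr dvdp0. Qed.

Let dC : 'X^K %| (l%:P - 'X) * \poly_(i < K) C i - Y.
Proof. exact: (sqrt_cubic_div_taylor _ l_gt0 HB HC'). Qed.

Let dD : 'X^K %| (b%:P - 'X) * \poly_(i < K) D i - Y.
Proof. exact: (sqrt_cubic_div_taylor _ b_gt0 HB HD). Qed.

Let one0 : (1 : {poly R}).[0] != 0.
Proof. by rewrite -polyC1 hornerC oner_neq0. Qed.

Let nonperiodicP : (elliptic_periodic a b n V /\ ~ periodic n V) <->
  exists c1 c2, [/\ c1 ^+ 2 = 1, c2 ^+ 2 = 1, sign_periodic n c1 c2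
    & c1 = -1 \/ c2 = -1].
Proof.
have pm (c : R) : c ^+ 2 = 1 -> c = 1 \/ c = -1.
  by move/eqP; rewrite sqrf_eq1 => /orP[] /eqP; [left|right].
have n11 : -1 <> 1 :> R by move=> h; have := @ltr01 R; lra.
split=> [[/elliptic_periodicP[c1 [c2 [c11 c22 H]]] np]|].
  exists c1, c2; split=> //; case: (pm _ c11) => E1; last by left.
  case: (pm _ c22) => E2; last by right.
  by case: np; apply/(periodicP c11 c22 H).
move=> [c1 [c2 [c11 c22 H or]]]; split.
  by apply/elliptic_periodicP; exists c1, c2.
by move/(periodicP c11 c22 H) => [E1 E2]; case: or; rewrite ?E1 ?E2 => /esym.
Qed.

Let pellE c1 c2 : c1 ^+ 2 = 1 -> c2 ^+ 2 = 1 -> sign_periodic n c1 c2 ->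
  exists p q, [/\ p ^+ 2 - q ^+ 2 * P = 'X^(n.*2),
    (size p <= n.+1)%N /\ p`_n = 1, 0 < (-1) ^+ n * p.[0],
    p.[a] = c1 * a ^+ n & p.[b] = c2 * b ^+ n].
Proof.
move=> c11 c22 [h1 h2 h3 h4].
exact: (pell_of_sign b_gt0 b_lt_a s_gt0 s2 onV unitE causticE t_gt0
    x1S x2S u1S u2S la lb (ltnW n_gt1) c11 c22 h1 h2 h3 h4).
Qed.

Let size_lin (z : R) : size (z%:P - 'X : {poly R}) = 2%N.
Proof. by rewrite -opprB size_polyN size_XsubC. Qed.

Let signE (f g : {poly R}) (z1 z2 : bool) : f * g = P -> f.[0] != 0 ->
  odd (size f + size g) -> (size f + (n - n./2).*2 <= n.+3)%N ->
  (size g + n./2.*2 <= n.+3)%N -> split_at0 n f Y ->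
  (if z1 then f else g).[a] = 0 -> (if z2 then f else g).[b] = 0 ->
  sign_periodic n ((if odd (n + size f) then 1 else -1) * (-1) ^+ z1)
    ((if odd (n + size f) then 1 else -1) * (-1) ^+ z2).
Proof.
move=> fg f0 ofg sf sg sp ga gb.
exact: (sign_of_split b_gt0 b_lt_a s_gt0 s2 onV unitE causticE t_gt0
  x1S x2S u1S u2S n_gt1 fg f0 ofg sf sg Y0 dY sp ga gb).
Qed.

Let dYn : 'X^n %| P - Y ^+ 2.
Proof. by apply: dvdp_trans dY; rewrite dvdp_exp2l. Qed.

Let half_le : (n./2.*2 <= n)%N.
Proof. by rewrite -[leqRHS]odd_double_half leq_addl. Qed.

Let lin_sign (z1 z2 : R) (w : bool) : 0 < z1 ->
  (z1%:P - 'X) * ((a%:P - 'X) * (z2%:P - 'X)) = P ->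
  (if w then z1%:P - 'X else (a%:P - 'X) * (z2%:P - 'X)).[b] = 0 ->
  split_at0 n (z1%:P - 'X) Y ->
  sign_periodic n ((-1) ^+ (~~ odd n)) ((-1) ^+ (~~ odd n) * (-1) ^+ w).
Proof.
move=> z10 fg gb sp.
have := @signE _ _ false w fg (lin0 z10); rewrite size_lin size_factor2.
have -> : (if odd (n + 2) then 1 else -1) = (-1) ^+ (~~ odd n) :> R.
  by rewrite oddD addbF; case: odd.
rewrite expr0 mulr1; apply=> //.
  by have := odd_double_half n; clear; case: odd; lia.
by rewrite !hornerS subrr mul0r.
Qed.

Let one_sign : odd n -> split_at0 n 1 Y -> sign_periodic n (-1) (-1).
Proof.
move=> on sp; have size_P : size P = 4%N.
  rewrite /P /cubic size_mul ?size_factor2 ?size_lin //.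
    by rewrite -size_poly_eq0 size_factor2.
  by rewrite -size_poly_eq0 size_lin.
have := @signE 1 P false false (mul1r P) one0.
have -> : (if odd (n + size (1 : {poly R})) then 1 else -1) = -1 :> R.
  by rewrite size_poly1 addn1 /= on.
rewrite expr0 mulr1 size_poly1 size_P; apply=> //.
- by have := odd_double_half n; rewrite on; clear; lia.
- by have := odd_double_half n; rewrite on; clear; lia.
- by rewrite /P /cubic !hornerS; ring.
- by rewrite /P /cubic !hornerS; ring.
Qed.

Let P_lin_l : (l%:P - 'X) * ((a%:P - 'X) * (b%:P - 'X)) = P.
Proof. by rewrite mulrC. Qed.

Let P_lin_b : (b%:P - 'X) * ((a%:P - 'X) * (l%:P - 'X)) = P.
Proof. by rewrite /P /cubic; ring. Qed.

(** Both signs agree, so failure of periodicity means that [n] bounces act as the central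
    symmetry. *)
Lemma ellipse_case : l < b ->
  (elliptic_periodic a b n V /\ ~ periodic n V) <->
  (exists m : nat, n = (2 * m)%N /\
     \det (\matrix_(i < m, j < m) C (i.+1 + j.+1 - 1)%N) = 0) \/
  (exists m : nat, n = (2 * m + 1)%N /\
     \det (\matrix_(i < m, j < m) B (i.+1 + j.+1)%N) = 0).
Proof.
move=> l_lt_b; rewrite (det_evenE (lin0 l_gt0) dC) (det_oddE one0 dB) nonperiodicP.
split=> [[c1 [c2 [c11 c22 H or]]]|].
  have [p [q [pell [sp _] p0 pa pb]]] := pellE c11 c22 H.
  have [E sp1] := ellipse_split b_gt0 b_lt_a l_gt0 n_gt1 pell sp p0 c11 c22
    pa pb dYn l_lt_b.
  have /sp1 : c1 = -1 by case: or; rewrite ?E.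
  by case: ifP => on H1; [right | left].
case=> -[on sp].
  exists (-1), (-1); rewrite sqrrN expr1n; split=> //; last by left.
  have := lin_sign (w := false) l_gt0 P_lin_l _ sp.
  rewrite (negPf on) /= expr0 expr1 mulr1; apply.
  by rewrite !hornerS subrr mulr0.
exists (-1), (-1); rewrite sqrrN expr1n; split=> //; last by left.
exact: one_sign.
Qed.

(** As [c2 = (-1)^n], the nontrivial sign pairs [(c1, c2)] are [(-1, 1)] for even [n], and
    [(-1, -1)] or [(1, -1)] for odd [n]. They match the three determinants in this order. *)
Lemma hyperbola_case : b < l -> l < a ->
  (elliptic_periodic a b n V /\ ~ periodic n V) <->
  ((exists m : nat, n = (2 * m)%N /\
     \det (\matrix_(i < m, j < m) D (i.+1 + j.+1 - 1)%N) = 0) \/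
   (exists m : nat, n = (2 * m + 1)%N /\
     \det (\matrix_(i < m, j < m) B (i.+1 + j.+1)%N) = 0)) \/
  (exists m : nat, n = (2 * m + 1)%N /\
     \det (\matrix_(i < m, j < m) D (i.+1 + j.+1)%N) = 0).
Proof.
move=> bl l_lt_a; rewrite (det_evenE (lin0 b_gt0) dD) !(det_oddE one0 dB).
rewrite (det_oddE (lin0 b_gt0) dD) nonperiodicP.
have pb0 : (if true then b%:P - 'X else (a%:P - 'X) * (l%:P - 'X)).[b] = 0 :> R.
  by rewrite !hornerS subrr.
split=> [[c1 [c2 [c11 c22 H or]]]|].
  have [p [q [pell [sp _] p0 pa pb]]] := pellE c11 c22 H.
  have [E [sp1 sp2]] := hyperbola_split b_gt0 b_lt_a l_gt0 n_gt1 pell sp p0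
    c11 c22 pa pb dYn bl l_lt_a.
  have n11 : 1 <> -1 :> R by move=> h; have := @ltr01 R; lra.
  move: E sp1 sp2; rewrite -signr_odd; case: (boolP (odd n)) => on E sp1 sp2.
    move/eqP: c11; rewrite sqrf_eq1 => /orP[] /eqP E1.
      by right; split=> //; exact: sp2.
    by left; right; split=> //; exact: sp1.
  left; left; split=> //; apply: sp1; case: or => // E2.
  by case: n11; rewrite -E2 E.
case=> [[]|] [on sp].
- exists (-1), 1; rewrite sqrrN expr1n; split=> //; last by left.
  have := lin_sign (w := true) b_gt0 P_lin_b pb0 sp.
  by rewrite (negPf on) /= !expr1 mulrNN mulr1.
- exists (-1), (-1); rewrite sqrrN expr1n; split=> //; last by left.
  exact: one_sign.
exists 1, (-1); rewrite sqrrN expr1n; split=> //; last by right.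
have := lin_sign (w := true) b_gt0 P_lin_b pb0 sp.
by rewrite on /= expr0 expr1 mul1r.
Qed.

End Trajectory.

Theorem theorem2p8 (R : realType) (a b l0 : R) (B C D : nat -> R) (n : nat)
    (V : nat -> 'rV[R]_2) :
  0 < b -> b < a ->
  (0 < l0 < b) \/ (b < l0 < a) ->
  taylor_expansion_at0 (fun x => sqrt_cubic a b l0 x) B ->
  taylor_expansion_at0 (fun x => sqrt_cubic a b l0 x / (l0 - x)) C ->
  taylor_expansion_at0 (fun x => sqrt_cubic a b l0 x / (b - x)) D ->
  (2 <= n)%N ->
  billiard_trajectory a b V ->
  has_caustic a b V l0 ->
  (elliptic_periodic a b n V /\ ~ periodic n V) <->
  [\/ is_ellipse b l0 /\
        ((exists m : nat, n = (2 * m)%N /\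
            \det (\matrix_(i < m, j < m) C (i.+1 + j.+1 - 1)%N) = 0) \/
         (exists m : nat, n = (2 * m + 1)%N /\
            \det (\matrix_(i < m, j < m) B (i.+1 + j.+1)%N) = 0)),
      is_hyperbola a b l0 /\
        ((exists m : nat, n = (2 * m)%N /\
            \det (\matrix_(i < m, j < m) D (i.+1 + j.+1 - 1)%N) = 0) \/
         (exists m : nat, n = (2 * m + 1)%N /\
            \det (\matrix_(i < m, j < m) B (i.+1 + j.+1)%N) = 0))
    | is_hyperbola a b l0 /\
        (exists m : nat, n = (2 * m + 1)%N /\
            \det (\matrix_(i < m, j < m) D (i.+1 + j.+1)%N) = 0)].
Proof.
move=> b0 ba [/andP[l0_gt0 lb]|bla] HB HC HD n1 HV HCa.
  have la : l0 < a := lt_trans lb ba.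
  have la' : l0 != a by rewrite lt_eqF.
  have lb' : l0 != b by rewrite lt_eqF.
  apply: (iff_trans (ellipse_case b0 ba la' lb' l0_gt0 HV HCa n1 HB HC lb)).
  split=> [H|]; first exact: Or31.
  case=> -[H1 H2] //; move: H1; rewrite /is_hyperbola ltNge (ltW lb) //.
have /andP[bl la] := bla; have l0_gt0 := lt_trans b0 bl.
have la' : l0 != a by rewrite lt_eqF.
have lb' : l0 != b by rewrite gt_eqF.
apply: (iff_trans (hyperbola_case b0 ba la' lb' l0_gt0 HV HCa n1 HB HD bl la)).
split=> [[H|H]|[] [H1 H2]]; first exact: Or32; first exact: Or33.
- by move: H1; rewrite /is_ellipse ltNge (ltW bl).
- by left.
- by right.
Qed.
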